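(* Let $E_1,\dots,E_n,F$ be Banach spaces such that $F$ and $E_i'$, for all $1\le i\le n$, are separable. Let $\mathfrak A$ be an $F$-Arens stable extendible ideal of $n$-linear operators with the $F$-Radon-Nikodým property. Then the space $\mathfrak A(E_1,\dots,E_n;F)$ is separable.
   Context: Banach spaces are over $\mathbb K=\mathbb R$ or $\mathbb C$; $E'$ is the dual of $E$. $\mathcal L(E_1,\dots,E_n;F)$ is the space of continuous $n$-linear operators with the sup norm on unit balls. A linear operator $S:E\to F$ is a metric surjection if it is surjective and $\|S(x)\|=\inf\{\|y\|:S(y)=S(x)\}$ for all $x$. Ideal of $n$-linear operators: a pair $(\mathfrak A,\|\cdot\|_{\mathfrak A})$ such that (i) each $\mathfrak A(E_1,\dots,E_n;F)=\mathfrak A\cap\mathcal L(E_1,\dots,E_n;F)$ is a linear subspace of $\mathcal L(E_1,\dots,E_n;F)$ and a Banach space under $\|\cdot\|_{\mathfrak A}$; (ii) if $R_j\in\mathcal L(X_j;E_j)$, $T\in\mathfrak A(E_1,\dots,E_n;F)$, $S\in\mathcal L(F;Y)$, then $S\circ T\circ(R_1,\dots,R_n)\in\mathfrak A(X_1,\dots,X_n;Y)$ with $\mathfrak A$-norm at most $\|S\|\,\|T\|_{\mathfrak A}\|R_1\|\cdots\|R_n\|$; (iii) $(\lambda_1,\dots,\lambda_n)\mapsto\lambda_1\cdots\lambda_n$ belongs to $\mathfrak A$ with norm $1$. Associated tensor norm ($\mathfrak A\sim\alpha$): $\alpha$ is the unique finitely generated tensor norm of order $n+1$ with $\mathfrak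 A(M_1,\dots,M_n;N)=(M_1'\otimes\cdots\otimes M_n'\otimes N;\alpha)$ isometrically for all finite dimensional $M_j,N$. (A tensor norm of order $m$ assigns to normed spaces $E_1,\dots,E_m$ a norm on $\otimes_j E_j$ with $\varepsilon\le\alpha\le\pi$ (injective and projective norms) and $\|T_1\otimes\cdots\otimes T_m\|\le\|T_1\|\cdots\|T_m\|$; it is finitely generated if $\alpha(z;\otimes E_j)=\inf\alpha(z;\otimes M_j)$ over finite dimensional $M_j\subset E_j$ with $z\in\otimes M_j$.) $\widetilde\otimes$ denotes completion. $F$-Radon-Nikodým property: for all index sets $J_1,\dots,J_n$ the canonical mapping $(\ell_1(J_1)\widetilde\otimes\cdots\widetilde\otimes\ell_1(J_n)\widetilde\otimes F,\alpha)\to\mathfrak A(c_0(J_1),\dots,c_0(J_n);F)$, $x_1'\otimes\cdots\otimes x_n'\otimes f\mapsto x_1'(\cdot)\cdots x_n'(\cdot)f$, is a metric surjection. Extendible: for all Banach spaces $E_j,F$, superspaces $G_j\supset E_j$ and $T\in\mathfrak A(E_1,\dots,E_n;F)$ there is an extension $\widetilde T\in\mathfrak A(G_1,\dots,G_n;F)$ of $T$ with the same $\mathfrak A$-norm. $F$-Arens stable: for $T\in\mathcal L(E_1,\dots,E_n;F)$ the $k$-Arens extension $Ext_k(T)\in\mathcal L(E_1,\dots,E_k'',\dots,E_n;F'')$ is $Ext_k(T)(x_1,\dots,x_k'',\dots,x_n)(y')=x_k''\big(z\mapsto y'(T(x_1,\dots,x_{k-1},z,x_{k+1},\dots,x_n))\big)$.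 $\mathfrak A$ is $F$-Arens stable if for all $1\le k\le n$ and all $E_1,\dots,E_n$, $Ext_k$ is well defined (in particular $F$-valued) and isometric as a map $\mathfrak A(E_1,\dots,E_n;F)\to\mathfrak A(E_1,\dots,E_{k-1},E_k'',E_{k+1},\dots,E_n;F)$. *)

(* Defs.v *)
From HB Require Import structures.
From mathcomp Require Import all_boot all_order all_algebra.
From mathcomp Require Import complex.
From mathcomp Require Import all_classical all_reals all_analysis.
From mathcomp Require summability.

Set Implicit Arguments.
Unset Strict Implicit.
Unset Printing Implicit Defensive.

Import Order.TTheory GRing.Theory Num.Theory numFieldNormedType.Exports.
Local Open Scope classical_set_scope.
Local Open Scope ring_scope.

Variant scalar_kind := RealScalars | ComplexScalars.

Definition scalar_field (R : realType) (k : scalar_kind) : numFieldType :=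
  match k with RealScalars => R | ComplexScalars => R[i] end.

Definition re_scalar (R : realType) (k : scalar_kind) :
    scalar_field R k -> R :=
  match k with RealScalars => id | ComplexScalars => @complex.Re R end.

Definition of_real (R : realType) (k : scalar_kind) :
    R -> scalar_field R k :=
  match k with RealScalars => id | ComplexScalars => real_complex R end.

(* Norms in a [normedModType K] are [K]-valued; [rnorm] is the real-valued
   norm. *)
Definition rnorm (R : realType) (k : scalar_kind)
    (V : normedModType (scalar_field R k)) (x : V) : R :=
  @re_scalar R k `|x|.

Section ScalarTheory.
Variables (R : realType) (k : scalar_kind).
Local Notation K := (scalar_field R k).
Local Notation re := (@re_scalar R k).
Local Notation ofR := (@of_real R k).

Lemma of_realK : cancel ofR re.
Proof. by rewrite /of_real /re_scalar; case: k. Qed.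

Lemma re_scalarK (x : K) : 0 <= x -> ofR (re x) = x.
Proof.
rewrite /of_real /re_scalar; case: k x => //= x x0.
by apply: RRe_real; rewrite realE x0.
Qed.

Lemma of_real_le a b : (ofR a <= ofR b) = (a <= b).
Proof. by rewrite /of_real; case: k => //=; rewrite lecR. Qed.

Lemma of_real_lt a b : (ofR a < ofR b) = (a < b).
Proof. by rewrite /of_real; case: k => //=; rewrite ltcR. Qed.

Lemma of_real0 : ofR 0 = 0.
Proof. by rewrite /of_real; case: k => //=. Qed.

Lemma of_real1 : ofR 1 = 1.
Proof. by rewrite /of_real; case: k => //=. Qed.

Lemma of_realD a b : ofR (a + b) = ofR a + ofR b.
Proof. by rewrite /of_real; case: k => //=; rewrite rmorphD. Qed.

Lemma of_realM a b : ofR (a * b) = ofR a * ofR b.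
Proof. by rewrite /of_real; case: k => //=; rewrite rmorphM. Qed.

Section Rnorm.
Variable V : normedModType K.
Implicit Types x y : V.

Lemma rnormE x : ofR (rnorm x) = `|x|.
Proof. by rewrite /rnorm re_scalarK. Qed.

Lemma rnorm_le x (M : R) : (rnorm x <= M) = (`|x| <= ofR M).
Proof. by rewrite -rnormE of_real_le. Qed.

Lemma rnorm_ge0 x : 0 <= rnorm x.
Proof. by rewrite -of_real_le of_real0 rnormE. Qed.

Lemma rnormD x y : rnorm (x + y) <= rnorm x + rnorm y.
Proof. by rewrite -of_real_le of_realD !rnormE ler_normD. Qed.

Lemma rnormZ (a : K) x : rnorm (a *: x) = rnorm a * rnorm x.
Proof.
by apply: (can_inj of_realK); rewrite of_realM !rnormE normrZ /rnorm re_scalarK.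
Qed.

Lemma rnorm0 : rnorm (0 : V) = 0.
Proof. by apply: (can_inj of_realK); rewrite rnormE normr0 of_real0. Qed.

Lemma rnorm0_eq0 x : rnorm x = 0 -> x = 0.
Proof. by move=> h; apply/normr0_eq0; rewrite -rnormE h of_real0. Qed.

End Rnorm.

Lemma rnorm1 : rnorm (1 : K) = 1.
Proof. by apply: (can_inj of_realK); rewrite of_real1 rnormE normr1. Qed.

Lemma rnormV (a : K) : rnorm a^-1 = (rnorm a)^-1.
Proof.
have [->|a0] := eqVneq a 0; first by rewrite invr0 rnorm0 invr0.
have ra : rnorm a != 0 by apply: contraNneq a0 => /rnorm0_eq0 ->.
apply: (mulfI ra); rewrite divff// -[LHS](@rnormZ K) [_ *: _](divff a0).
exact: rnorm1.
Qed.

Lemma scalar_complete (F : set_system K) :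
  ProperFilter F -> cauchy F -> cvg F.
Proof.
rewrite /scalar_field; case: k F => F; first exact: R_complete.
move=> FF /cauchy_ballP Fc.
have part (p : R[i] -> R) :
    (forall x y, `|p x - p y|%:C%C <= `|x - y|) -> cvg (p x @[x --> F]).
  move=> hp; apply: R_complete; apply/cauchy_ballP => e e0.
  have e0' : 0 < (e%:C)%C :> R[i] by rewrite ltcR.
  have := Fc _ e0'; rewrite !near_simpl => H.
  have [/= [P Q] [/= FP FQ] PQ] := H.
  exists (p @` P, p @` Q).
    split => /=; rewrite ?nbhs_simpl /=.
      by apply: filterS FP => x; exists x.
    by apply: filterS FQ => x; exists x.
  move=> [_ _] /= [[x Px <-] [y Qy <-]].
  have /= := PQ (x, y) (conj Px Qy).
  rewrite /ball /= => xy.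
  by rewrite -ltcR; apply: le_lt_trans xy.
have Recvg : cvg (complex.Re x @[x --> F]).
  by apply: part => x y; rewrite -raddfB; exact: normc_ge_Re.
have Imcvg : cvg (complex.Im x @[x --> F]).
  apply: part => x y; rewrite -raddfB normc_def lecR -sqrtr_sqr.
  by rewrite ler_wsqrtr// lerDr sqr_ge0.
have [a Fa] := (cvg_ex _).1 Recvg; have [b Fb] := (cvg_ex _).1 Imcvg.
apply/cvg_ex; exists (a +i* b)%C.
apply/cvgrPdist_le => e e0.
have eR : e = (complex.Re e)%:C%C by rewrite RRe_real// realE ltW.
have d0 : 0 < complex.Re e / 2 by rewrite divr_gt0// -ltcR -eR.
have /cvgrPdist_le/(_ _ d0) Ha := Fa; have /cvgrPdist_le/(_ _ d0) Hb := Fb.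
have xab (y : R[i]) :
    (a +i* b)%C - y = ((a - complex.Re y) +i* (b - complex.Im y))%C by case: y.
have le2 (u v : R) : `|(u +i* v)%C| <= (`|u| + `|v|)%:C%C.
  rewrite normc_def lecR /= -[leRHS]ger0_norm ?addr_ge0// -sqrtr_sqr.
  rewrite ler_wsqrtr// sqrrD !real_normK ?num_real// lerD2r lerDl.
  by rewrite mulrn_wge0// mulr_ge0.
near=> x; rewrite xab; apply: le_trans (le2 _ _) _; rewrite eR lecR.
rewrite (splitr (complex.Re e)).
by apply: lerD; near: x; [exact: Ha|exact: Hb].
Unshelve. all: by end_near. Qed.
End ScalarTheory.

(* [K] as a Banach space over itself. *)
Definition scalar_banach (R : realType) (k : scalar_kind) :
    completeNormedModType (scalar_field R k) :=
  HB.pack_for (completeNormedModType (scalar_field R k)) (scalar_field R k)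
    (Uniform_isComplete.Build (scalar_field R k) (@scalar_complete R k)).

Definition sup_norm (R : realType) (k : scalar_kind) (X : Type)
    (V : normedModType (scalar_field R k)) (B : set X) (f : X -> V) : R :=
  sup [set rnorm (f x) | x in B].

Definition op_norm (R : realType) (k : scalar_kind)
    (E F : normedModType (scalar_field R k)) (S : E -> F) : R :=
  sup_norm [set x | rnorm x <= 1] S.

Section SupNorm.
Variables (R : realType) (k : scalar_kind).
Local Notation K := (scalar_field R k).
Variables (X : Type) (V : normedModType K) (B : set X).
Implicit Types f g : X -> V.

Definition bounded_over f := exists M : R, forall x, B x -> rnorm (f x) <= M.

Lemma sup_norm_ub f x : bounded_over f -> B x -> rnorm (f x) <= sup_norm B f.
Proof.
move=> [M fM] Bx; apply: ub_le_sup; last by exists x.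
by exists M => _ [y By <-]; exact: fM.
Qed.

Lemma sup_norm_le f (M : R) :
  0 <= M -> (forall x, B x -> rnorm (f x) <= M) -> sup_norm B f <= M.
Proof.
move=> M0 fM; have [->|/set0P B0] := eqVneq B set0.
  by rewrite /sup_norm image_set0 sup0.
apply: ge_sup; first by have [x Bx] := B0; exists (rnorm (f x)), x.
by move=> _ [y By <-]; exact: fM.
Qed.

Lemma sup_norm_ge0 f : 0 <= sup_norm B f.
Proof.
have [hs|/sup_out h] := pselect (has_sup [set rnorm (f x) | x in B]).
  have [[_ [x Bx _]] bf] := hs.
  by apply: le_trans (rnorm_ge0 (f x)) (ub_le_sup bf _); exists x.
by rewrite /sup_norm h.
Qed.

Lemma sup_normD f g : bounded_over f -> bounded_over g ->
  sup_norm B (f + g) <= sup_norm B f + sup_norm B g.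
Proof.
move=> bf bg; apply: sup_norm_le; first by rewrite addr_ge0 ?sup_norm_ge0.
move=> x Bx; apply: le_trans (rnormD _ _) _.
by apply: lerD; exact: sup_norm_ub.
Qed.

Lemma sup_normZ (a : K) f : bounded_over f ->
  sup_norm B (a *: f) = rnorm a * sup_norm B f.
Proof.
move=> bf; have le (c : K) g : bounded_over g ->
    sup_norm B (c *: g) <= rnorm c * sup_norm B g.
  move=> bg; apply: sup_norm_le; first by rewrite mulr_ge0 ?rnorm_ge0
    ?sup_norm_ge0.
  by move=> x Bx; rewrite rnormZ ler_wpM2l ?rnorm_ge0 ?sup_norm_ub.
apply/eqP; rewrite eq_le le//=.
have [->|a0] := eqVneq a 0; first by rewrite rnorm0 mul0r sup_norm_ge0.
have ra : 0 < rnorm a.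
  rewrite lt_neqAle rnorm_ge0 andbT eq_sym.
  by apply: contraNneq a0 => /rnorm0_eq0 ->.
rewrite -ler_pdivlMl// -[f in leLHS](scalerK a0) -rnormV.
apply: le; have [M fM] := bf; exists (rnorm a * M) => x Bx.
by rewrite rnormZ ler_wpM2l ?rnorm_ge0 ?fM.
Qed.

End SupNorm.

Section CauchyPointwise.
Variables (R : realType) (k : scalar_kind).
Local Notation K := (scalar_field R k).

Lemma cauchy_pointwise (X : Type) (V : normedModType K) (ev : V -> X -> K)
    (w : X -> K) (F : set_system V) :
  (forall f g x, `|ev f x - ev g x| <= `|f - g| * w x) ->
  (forall x, 0 <= w x) -> ProperFilter F -> cauchy F ->
  exists g : X -> K, (forall x, ev f x @[f --> F] --> g x) /\
    forall e : K, 0 < e ->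
      \forall f \near F, forall x, `|g x - ev f x| <= e * w x.
Proof.
move=> evw w0 FF /cauchy_ballP Fc.
have /(_ _)/cvg_ex cv x : cvg (ev f x @[f --> F]).
  apply: scalar_complete; apply/cauchy_ballP => e e0.
  have d0 : 0 < e / (w x + 1) by rewrite divr_gt0// ltr_wpDl.
  have := Fc _ d0; rewrite !near_simpl => -[/= [P Q] [/= FP FQ] PQ].
  exists ((ev^~ x) @` P, (ev^~ x) @` Q).
    split => /=; rewrite ?nbhs_simpl /=.
      by apply: filterS FP => f; exists f.
    by apply: filterS FQ => f; exists f.
  move=> [_ _] /= [[f Pf <-] [g Qg <-]].
  have /= := PQ (f, g) (conj Pf Qg).
  rewrite -!ball_normE /= => fg.
  apply: (le_lt_trans (evw _ _ _)).
  apply: (@le_lt_trans _ _ (`|f - g| * (w x + 1))).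
    by rewrite ler_wpM2l// lerDl.
  by rewrite -ltr_pdivlMr// ltr_wpDl.
have [g cg] := choice cv; exists g; split => // e e0.
have := Fc _ e0; rewrite !near_simpl => -[/= [P Q] [/= FP FQ] PQ].
apply: filterS FP => f Pf x.
apply/ler_addgt0Pr => d d0.
have /cvgrPdist_le/(_ _ d0) := cg x; rewrite near_simpl => gd.
have [h [hd Qh]] := filter_ex (filterI gd FQ).
rewrite (_ : g x - ev f x = (ev h x - ev f x) + (g x - ev h x)); last first.
  by rewrite [RHS]addrC addrA subrK.
apply: le_trans (ler_normD _ _) _; apply: lerD => //.
rewrite distrC; apply: le_trans (evw _ _ _) _; rewrite ler_wpM2r//.
by have := PQ (f, h) (conj Pf Qh); rewrite -ball_normE /= => /ltW.
Qed.
End CauchyPointwise.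

Section Dual.
Variables (R : realType) (k : scalar_kind).
Local Notation K := (scalar_field R k).
Variable E : normedModType K.

Definition dual_pred : {pred E -> K} :=
  mem [set f : E -> K | linear f /\ continuous f].

Record dual := Dual { dual_fun :> E -> K; _ : dual_fun \in dual_pred }.

HB.instance Definition _ := [isSub for dual_fun].
HB.instance Definition _ := [Choice of dual by <:].

Lemma dual_linear (f : dual) : linear f.
Proof. by case: f => f /=; rewrite inE => -[]. Qed.

Lemma dual_continuous (f : dual) : continuous f.
Proof. by case: f => f /=; rewrite inE => -[]. Qed.

Lemma dual_submod_closed : submod_closed dual_pred.
Proof.
split.
  rewrite inE; split; last exact: cst_continuous.
  move=> a x y; rewrite -[LHS]/(0 : K) -[RHS]/(a *: (0 : K) + 0).
  by rewrite scaler0 addr0.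
move=> a f g; rewrite !inE => -[lf cf] [lg cg]; split.
  move=> b x y; rewrite -[LHS]/(a *: f (b *: x + y) + g (b *: x + y)).
  rewrite -[RHS]/(b *: (a *: f x + g x) + (a *: f y + g y)) lf lg.
  by rewrite !scalerDr !scalerA (mulrC a b) addrACA.
move=> x; apply: cvgD; last exact: cg.
by apply: cvgZ; [exact: cvg_cst|exact: cf].
Qed.

HB.instance Definition _ :=
  GRing.isSubmodClosed.Build K (E -> K) dual_pred dual_submod_closed.
HB.instance Definition _ := [SubChoice_isSubLmodule of dual by <:].

HB.instance Definition _ (f : dual) :=
  GRing.isLinear.Build K E K *%R (dual_fun f) (dual_linear f).

Lemma dual_bounded (f : dual) : bounded_over [set x : E | rnorm x <= 1] f.
Proof.
have /linear_bounded_continuous/linear_boundedP[M [Mreal fM]] :=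
  @dual_continuous f.
have M1 : M < `|M| + 1 by rewrite (le_lt_trans (real_ler_norm Mreal))// ltrDl.
exists (re_scalar (`|M| + 1)) => x /=; rewrite !rnorm_le re_scalarK ?addr_ge0//.
rewrite of_real1 => x1; apply: le_trans (fM _ M1 x) _.
by rewrite ler_piMr// addr_ge0.
Qed.

Lemma dual_op_le (f : dual) x : rnorm (f x) <= op_norm f * rnorm x.
Proof.
have [->|x0] := eqVneq x 0; first by rewrite linear0 !rnorm0 mulr0.
have rx : 0 < rnorm x by rewrite -(@of_real_lt R k) of_real0 rnormE normr_gt0.
rewrite -ler_pdivrMr// mulrC.
have hr : rnorm (`|x|^-1 : K) = (rnorm x)^-1.
  by rewrite rnormV; congr (_^-1); rewrite {1}/rnorm normr_id.
rewrite -hr -rnormZ -linearZ; apply: sup_norm_ub; first exact: dual_bounded.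
by rewrite /= rnormZ hr mulVf// lt0r_neq0.
Qed.

Let dual_norm (f : dual) : K := of_real k (op_norm f).

Let dual_normD f g : dual_norm (f + g) <= dual_norm f + dual_norm g.
Proof.
rewrite /dual_norm -of_realD of_real_le.
by apply: sup_normD; exact: dual_bounded.
Qed.

Let dual_normZ (a : K) f : dual_norm (a *: f) = `|a| * dual_norm f.
Proof.
rewrite /dual_norm -rnormE -of_realM; congr of_real.
by apply: sup_normZ; exact: dual_bounded.
Qed.

Let dual_norm0_eq0 f : dual_norm f = 0 -> f = 0.
Proof.
rewrite /dual_norm -(of_real0 R k) => /(can_inj (@of_realK R k)) f0.
apply/val_inj/funext => x; apply: rnorm0_eq0; apply/eqP.
by rewrite eq_le rnorm_ge0 andbT -(mul0r (rnorm x)) -f0 dual_op_le.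
Qed.

HB.instance Definition _ :=
  Lmodule_isNormed.Build K dual dual_normD dual_normZ dual_norm0_eq0.

Lemma dual_normE (f : dual) : rnorm f = op_norm f.
Proof. exact: of_realK. Qed.

Lemma dual_complete (F : set_system dual) :
  ProperFilter F -> cauchy F -> cvg F.
Proof.
move=> FF Fc.
have evw (f g : dual) (x : E) : `|f x - g x| <= `|f - g| * `|x|.
  rewrite -!rnormE -of_realM of_real_le dual_normE.
  exact: (dual_op_le (f - g)).
have [g [cg ug]] := cauchy_pointwise evw (fun x => normr_ge0 x) FF Fc.
have lg : linear g.
  move=> a x y; have c1 := cg (a *: x + y).
  have c2 : (fun f : dual => f (a *: x + y)) @ F --> (a *: g x + g y).
    rewrite (_ : (fun f : dual => _) = (fun f : dual => a *: f x + f y)).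
      by apply: cvgD; [apply: cvgZ; [exact: cvg_cst|exact: cg]|exact: cg].
    by apply/funext => f; rewrite dual_linear.
  exact: (norm_cvg_unique c1 c2).
have gc : continuous g.
  pose G := GRing.isLinear.Build K E K *%R g lg.
  pose L : {linear E -> K} := HB.pack g G.
  change (continuous (L : E -> K)).
  have [f f1] := filter_ex (ug 1 ltr01).
  have /linear_bounded_continuous/linear_boundedP[M [Mreal fM]] :=
  @dual_continuous f.
  apply/linear_bounded_continuous/linear_boundedP; exists (M + 1).
  split=> [|r Mr x]; first by apply: realD => //; exact: real1.
  rewrite -[L x](subrK (f x)); apply: le_trans (ler_normD _ _) _.
  rewrite -[r](subrK 1) mulrDl mul1r addrC; apply: lerD.
    by apply: fM; rewrite ltrBrDr.
  by rewrite -[leRHS]mul1r; exact: f1.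
have gP : g \in dual_pred by rewrite inE.
apply/cvg_ex; exists (Dual gP); apply/cvgrPdist_le => e e0.
apply: filterS (ug e e0) => f fe.
rewrite -rnormE -(re_scalarK (ltW e0)) of_real_le dual_normE.
apply: sup_norm_le.
  by rewrite -(@of_real_le R k) of_real0 (re_scalarK (ltW e0)) ltW.
move=> x; rewrite /= rnorm_le of_real1 => x1.
rewrite rnorm_le (re_scalarK (ltW e0)).
rewrite -[leLHS]/(`|g x - f x|); apply: le_trans (fe x) _.
by rewrite ler_piMr// ltW.

Qed.

HB.instance Definition _ := Uniform_isComplete.Build dual dual_complete.
End Dual.

Section C0.
Variables (R : realType) (k : scalar_kind) (J : choiceType).
Local Notation K := (scalar_field R k).

Definition c0_pred : {pred J -> K} :=
  mem [set x : J -> K | forall e : R, 0 < e ->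
    finite_set [set j | e <= rnorm (x j)]].

Record c0 := C0 { c0_fun :> J -> K; _ : c0_fun \in c0_pred }.

HB.instance Definition _ := [isSub for c0_fun].
HB.instance Definition _ := [Choice of c0 by <:].

Lemma c0_submod_closed : submod_closed c0_pred.
Proof.
split.
  rewrite inE => e e0; rewrite (_ : [set j | _] = set0)//.
  by apply/seteqP; split=> // j /=; rewrite rnorm0 leNgt e0.
move=> a x y; rewrite !inE => cx cy e e0.
pose d := e / (2 * (rnorm a + 1)).
have a1 : 0 < rnorm a + 1 by rewrite ltr_wpDl// rnorm_ge0.
have d0 : 0 < d by rewrite divr_gt0// mulr_gt0.
have e20 : 0 < e / 2 by rewrite divr_gt0.
have fU : finite_set
    ([set j | d <= rnorm (x j)] `|` [set j | e / 2 <= rnorm (y j)]).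
  by rewrite finite_setU; split; [exact: cx|exact: cy].
apply: (sub_finite_set _ fU) => j /= ej.
apply/orP; rewrite -implyNb -ltNge; apply/implyP => xd.
rewrite leNgt; apply/negP => ye.
suff : e < e by rewrite ltxx.
apply: (le_lt_trans ej); apply: (le_lt_trans (rnormD (a *: x j) (y j))).
rewrite [ltRHS]splitr ler_ltD// rnormZ.
apply: (@le_trans _ _ ((rnorm a + 1) * d)).
  by apply: ler_pM; rewrite ?rnorm_ge0 ?lerDl// ltW.
by rewrite /d invfM mulrCA (mulrC 2^-1) mulVKf// lt0r_neq0.
Qed.

HB.instance Definition _ :=
  GRing.isSubmodClosed.Build K (J -> K) c0_pred c0_submod_closed.
HB.instance Definition _ := [SubChoice_isSubLmodule of c0 by <:].

Lemma c0_bounded (x : c0) : bounded_over [set: J] x.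
Proof.
case: x => x /=; rewrite inE => /(_ 1 ltr01) fx.
exists (1 + \sum_(j \in [set j | 1 <= rnorm (x j)]) rnorm (x j)) => j _.
have s0 : 0 <= \sum_(j \in [set j | 1 <= rnorm (x j)]) rnorm (x j).
  by rewrite fsbig_finite//= sumr_ge0// => i _; exact: rnorm_ge0.
have [j1|/ltW j1] := leP 1 (rnorm (x j)); last by rewrite -[leLHS]addr0 lerD.
rewrite (fsbigD1 j)//= addrCA lerDl addr_ge0//.
rewrite fsbig_finite//=; last exact: finite_setD.
by rewrite sumr_ge0// => i _; exact: rnorm_ge0.
Qed.

Let c0_norm (x : c0) : K := of_real k (sup_norm [set: J] x).

Let c0_normD x y : c0_norm (x + y) <= c0_norm x + c0_norm y.
Proof.
rewrite /c0_norm -of_realD of_real_le.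
by apply: sup_normD; exact: c0_bounded.
Qed.

Let c0_normZ (a : K) x : c0_norm (a *: x) = `|a| * c0_norm x.
Proof.
rewrite /c0_norm -rnormE -of_realM; congr of_real.
by apply: sup_normZ; exact: c0_bounded.
Qed.

Let c0_norm0_eq0 x : c0_norm x = 0 -> x = 0.
Proof.
rewrite /c0_norm -(of_real0 R k) => /(can_inj (@of_realK R k)) x0.
apply/val_inj/funext => j; apply: rnorm0_eq0; apply/eqP.
rewrite eq_le rnorm_ge0 andbT -x0.
by apply: sup_norm_ub => //; exact: c0_bounded.
Qed.

HB.instance Definition _ :=
  Lmodule_isNormed.Build K c0 c0_normD c0_normZ c0_norm0_eq0.

Lemma c0_normE (x : c0) : rnorm x = sup_norm [set: J] x.
Proof. exact: of_realK. Qed.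

Lemma c0_complete (F : set_system c0) :
  ProperFilter F -> cauchy F -> cvg F.
Proof.
move=> FF Fc.
have evw (x y : c0) (j : J) : `|x j - y j| <= `|x - y| * 1.
  rewrite mulr1 -!rnormE of_real_le c0_normE.
  by apply: (@sup_norm_ub _ _ _ _ _ (x - y)) => //; exact: c0_bounded.
have [g [cg ug]] := cauchy_pointwise evw (fun=> ler01) FF Fc.
have gP : g \in c0_pred.
  rewrite inE => e e0; have e20 : 0 < e / 2 by rewrite divr_gt0.
  have := ug (of_real k (e / 2)).
  rewrite -(of_real0 R k) of_real_lt => /(_ e20).
  move=> /filter_ex[[x xP] /= gx].
  move: (xP); rewrite inE => /(_ _ e20); apply: sub_finite_set => j /= ej.
  have := gx j; rewrite mulr1 -rnormE of_real_le => gxj.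
  have := rnormD (g j - x j) (x j); rewrite subrK => h.
  have : e <= e / 2 + rnorm (x j).
    by apply: (le_trans (le_trans ej h)); rewrite lerD2r.
  by rewrite {1}(splitr e) lerD2l.
apply/cvg_ex; exists (C0 gP); apply/cvgrPdist_le => e e0.
apply: filterS (ug e e0) => x xe.
rewrite -rnormE -(re_scalarK (ltW e0)) of_real_le c0_normE.
apply: sup_norm_le.
  by rewrite -(@of_real_le R k) of_real0 (re_scalarK (ltW e0)) ltW.
move=> j _; rewrite /= rnorm_le (re_scalarK (ltW e0)).
by have := xe j; rewrite mulr1.
Qed.

HB.instance Definition _ := Uniform_isComplete.Build c0 c0_complete.
End C0.

Section L1.
Variables (R : realType) (k : scalar_kind) (J : choiceType).
Local Notation K := (scalar_field R k).

Definition l1_mass (x : J -> K) : \bar R :=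
  (\esum_(j in [set: J]) (rnorm (x j))%:E)%E.

Definition l1_pred : {pred J -> K} :=
  mem [set x : J -> K | (l1_mass x < +oo)%E].

Record l1 := L1 { l1_fun :> J -> K; _ : l1_fun \in l1_pred }.

HB.instance Definition _ := [isSub for l1_fun].
HB.instance Definition _ := [Choice of l1 by <:].

Lemma l1_mass_ge0 (x : J -> K) : (0 <= l1_mass x)%E.
Proof. by apply: esum_ge0 => j _; rewrite lee_fin rnorm_ge0. Qed.

Lemma l1_massD (x y : J -> K) : (l1_mass (x + y)%R <= l1_mass x + l1_mass y)%E.
Proof.
rewrite /l1_mass -esumD; [|by move=> j _; rewrite lee_fin rnorm_ge0..].
by apply: le_esum => j _; rewrite -EFinD lee_fin rnormD.
Qed.

Lemma l1_massZ_le (a : K) (x : J -> K) :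
  (l1_mass (a *: x)%R <= (rnorm a)%:E * l1_mass x)%E.
Proof.
apply: ge_ereal_sup => _ [A [finA _] <-].
rewrite (eq_fsbigr (fun j => (rnorm a)%:E * (rnorm (x j))%:E)%E); last first.
  by move=> j _; rewrite -EFinM rnormZ.
rewrite -ge0_mule_fsumr; last by move=> j; rewrite lee_fin rnorm_ge0.
apply: lee_wpmul2l; first by rewrite lee_fin rnorm_ge0.
by apply: esum_ge; exists A.
Qed.

Lemma l1_submod_closed : submod_closed l1_pred.
Proof.
split.
  rewrite inE /= (_ : l1_mass 0 = 0%E) ?ltry// /l1_mass esum1// => j _.
  by rewrite rnorm0.
move=> a x y; rewrite !inE /= => lx ly.
apply: (le_lt_trans (l1_massD _ _)); rewrite lte_add_pinfty//.
apply: (le_lt_trans (l1_massZ_le _ _)).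
by rewrite lte_mul_pinfty// lee_fin rnorm_ge0.
Qed.

HB.instance Definition _ :=
  GRing.isSubmodClosed.Build K (J -> K) l1_pred l1_submod_closed.
HB.instance Definition _ := [SubChoice_isSubLmodule of l1 by <:].

Lemma l1_mass_fin (x : l1) : l1_mass x \is a fin_num.
Proof.
by rewrite ge0_fin_numE ?l1_mass_ge0//; case: x => x /=; rewrite inE.
Qed.

Let l1_norm (x : l1) : K := of_real k (fine (l1_mass x)).

Let l1_normD x y : l1_norm (x + y) <= l1_norm x + l1_norm y.
Proof.
rewrite /l1_norm -of_realD of_real_le -fineD ?l1_mass_fin//.
by rewrite fine_le ?fin_numD ?l1_mass_fin//; exact: l1_massD.
Qed.

Let l1_normZ (a : K) x : l1_norm (a *: x) = `|a| * l1_norm x.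
Proof.
rewrite /l1_norm -rnormE -of_realM; congr of_real.
have le (c : K) (y : l1) :
    fine (l1_mass (c *: y)) <= rnorm c * fine (l1_mass y).
  rewrite -[rnorm c]/(fine (rnorm c)%:E) -fineM ?l1_mass_fin//.
  by rewrite fine_le ?fin_numM ?l1_mass_fin//; exact: l1_massZ_le.
apply/eqP; rewrite eq_le le//=.
have [->|a0] := eqVneq a 0.
  by rewrite rnorm0 mul0r fine_ge0 ?l1_mass_ge0.
have ra : 0 < rnorm a.
  rewrite lt_neqAle rnorm_ge0 andbT eq_sym.
  by apply: contraNneq a0 => /rnorm0_eq0 ->.
rewrite -ler_pdivlMl// -[x in leLHS](scalerK a0) -rnormV.
exact: le.
Qed.

Let l1_norm0_eq0 x : l1_norm x = 0 -> x = 0.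
Proof.
rewrite /l1_norm -(of_real0 R k) => /(can_inj (@of_realK R k)) x0.
apply/val_inj/funext => j; apply: rnorm0_eq0; apply/eqP.
rewrite eq_le rnorm_ge0 andbT -x0 -lee_fin fineK ?l1_mass_fin//.
by apply: esum_ge; exists [set j]; rewrite ?fsbig_set1//; split.
Qed.

HB.instance Definition _ :=
  Lmodule_isNormed.Build K l1 l1_normD l1_normZ l1_norm0_eq0.

Lemma l1_normE (x : l1) : rnorm x = fine (l1_mass x).
Proof. exact: of_realK. Qed.

End L1.

Section Multilinear.
Variables (R : realType) (k : scalar_kind) (I : finType).
Local Notation K := (scalar_field R k).

Definition multilinear (E : I -> normedModType K) (F : normedModType K)
    (T : (forall i, E i) -> F) : Prop :=
  forall (x : forall i, E i) (i : I), linear (fun z : E i => T (dfwith x i z)).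

Definition continuous_multilinear (E : I -> normedModType K)
    (F : normedModType K) (T : (forall i, E i) -> F) : Prop :=
  multilinear T /\ continuous (T : prod_topology E -> F).

(* Multilinear forms, not necessarily continuous. *)
Definition mform (E : I -> normedModType K) : Type :=
  {phi : (forall i, E i) -> K | multilinear phi}.

End Multilinear.

(* The algebraic tensor product of the [E i] is realized as the space of
   functionals on multilinear forms spanned by the evaluations
   [phi |-> phi x]; the evaluation at [x] is the elementary tensor of the
   [x i]. *)
Section Tensor.
Variables (R : realType) (k : scalar_kind) (I : finType).
Local Notation K := (scalar_field R k).
Variable E : I -> normedModType K.

Definition mform_eval (x : forall i, E i) : mform E -> K :=
  fun phi => sval phi x.

Definition mform_comb (s : seq (K * (forall i, E i))) : mform E -> K :=
  \sum_(p <- s) p.1 *: mform_eval p.2.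

Lemma mform_combE s phi : mform_comb s phi = \sum_(p <- s) p.1 * sval phi p.2.
Proof.
elim: s => [|p s IHs]; rewrite /mform_comb ?big_nil// !big_cons -IHs.
by [].
Qed.

Definition tensor_pred : {pred mform E -> K} := mem (range mform_comb).

Record tensor :=
  Tensor { tensor_fun :> mform E -> K; _ : tensor_fun \in tensor_pred }.

HB.instance Definition _ := [isSub for tensor_fun].
HB.instance Definition _ := [Choice of tensor by <:].

Lemma tensor_submod_closed : submod_closed tensor_pred.
Proof.
split; first by rewrite inE; exists [::] => //; rewrite /mform_comb big_nil.
move=> a _ _ /set_mem[s _ <-] /set_mem[t _ <-]; apply/mem_set.
exists ([seq (a * p.1, p.2) | p <- s] ++ t) => //.
rewrite /mform_comb big_cat big_map /= scaler_sumr; congr (_ + _).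
by apply: eq_bigr => p _; rewrite scalerA.
Qed.

HB.instance Definition _ :=
  GRing.isSubmodClosed.Build K (mform E -> K) tensor_pred tensor_submod_closed.
HB.instance Definition _ := [SubChoice_isSubLmodule of tensor by <:].

Lemma mform_eval_tensor x : mform_eval x \in tensor_pred.
Proof.
apply/mem_set; exists [:: (1, x)] => //.
by rewrite /mform_comb big_seq1 scale1r.
Qed.

Definition elem_tensor (x : forall i, E i) : tensor :=
  Tensor (mform_eval_tensor x).

Definition tensor_comb (s : seq (K * (forall i, E i))) : tensor :=
  \sum_(p <- s) p.1 *: elem_tensor p.2.

Lemma tensor_combE s : tensor_comb s = mform_comb s :> (mform E -> K).
Proof. by rewrite -[LHS]/(val _) /tensor_comb raddf_sum. Qed.

Lemma tensor_combP z : exists s, z = tensor_comb s.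
Proof.
case: z => z /[dup] + zP => /set_mem[s _ sz]; exists s; apply/val_inj.
by rewrite /= tensor_combE.
Qed.

Lemma prod_form_multilinear (phi : forall i, dual (E i)) :
  multilinear (fun x : forall i, E i => \prod_i phi i (x i) : K).
Proof.
move=> x i a u v; rewrite !(bigD1 (P := xpredT) i)//= !dfwithin.
rewrite dual_linear mulrDl -scalerAl.
have out (w : E i) : \prod_(j | j != i) phi j (dfwith x i w j) =
    \prod_(j | j != i) phi j (x j).
  by apply: eq_bigr => j ji; rewrite dfwithout// eq_sym.
by rewrite !out.
Qed.

Definition prod_form (phi : forall i, dual (E i)) : mform E :=
  exist _ _ (prod_form_multilinear phi).

Definition injective_norm (z : tensor) : R :=
  sup [set rnorm (z (prod_form phi)) |
       phi in [set phi : forall i, dual (E i) | forall i, rnorm (phi i) <= 1]].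

(* The coefficients [p.1] can be absorbed in one of the factors, so that the
   infimum is the usual one over the representations of [z] as a sum of
   elementary tensors. *)
Definition projective_norm (z : tensor) : R :=
  inf [set \sum_(p <- s) rnorm p.1 * \prod_i rnorm (p.2 i) |
       s in [set s | z = tensor_comb s]].

End Tensor.

Section TensorMap.
Variables (R : realType) (k : scalar_kind) (I : finType).
Local Notation K := (scalar_field R k).
Variables (E G : I -> normedModType K) (T : forall i, {linear E i -> G i}).

Lemma pullback_multilinear (phi : mform G) :
  multilinear (fun x : forall i, E i => sval phi (fun i => T i (x i))).
Proof.
case: phi => phi mphi /= x i a u v.
have dT (w : E i) : (fun j => T j (dfwith x i w j)) =
    dfwith (fun j => T j (x j)) i (T i w).
  apply/functional_extensionality_dep => j.
  by case: dfwithP => [|j' ij]; rewrite ?dfwithin ?dfwithout.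
by rewrite !dT linearP; exact: mphi.
Qed.

Definition pullback (phi : mform G) : mform E :=
  exist _ _ (pullback_multilinear phi).

Lemma tensor_map_subproof (z : tensor E) :
  (fun phi : mform G => z (pullback phi)) \in @tensor_pred R k I G.
Proof.
have [s ->] := tensor_combP z; apply/mem_set.
exists [seq (p.1, fun i => T i (p.2 i)) | p <- s] => //.
by apply/funext => phi; rewrite tensor_combE !mform_combE big_map.
Qed.

Definition tensor_map (z : tensor E) : tensor G :=
  Tensor (tensor_map_subproof z).

Lemma tensor_map_elem x :
  tensor_map (elem_tensor x) = elem_tensor (fun i => T i (x i)).
Proof. exact: val_inj. Qed.

End TensorMap.

Section Notions.
Variables (R : realType) (k : scalar_kind).
Local Notation K := (scalar_field R k).
Local Notation Banach := (completeNormedModType K).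

Definition separable (T : topologicalType) : Prop :=
  exists D : set T, countable D /\ dense D.

(* A normed space given as a set [D] in a vector space [V] of operators or
   tensors, with a norm [N] that is only meaningful on [D]. *)
Section NormedSet.
Variables (V : lmodType K) (D : set V) (N : V -> R).

Definition subspace_set : Prop :=
  D 0 /\ forall (a : K) x y, D x -> D y -> D (a *: x + y).

Definition norm_on : Prop :=
  [/\ forall x y, D x -> D y -> N (x + y) <= N x + N y,
      forall (a : K) x, D x -> N (a *: x) = rnorm a * N x &
      forall x, D x -> N x = 0 -> x = 0].

Definition complete_on : Prop :=
  forall u : nat -> V, (forall m, D (u m)) ->
  (forall e : R, 0 < e ->
     exists p : nat, forall l m, (p <= l)%N -> (p <= m)%N ->
       N (u l - u m) < e) ->
  exists2 v, D v & N (u m - v) @[m --> \oo] --> (0 : R).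

Definition separable_on : Prop :=
  exists C : set V, [/\ countable C, C `<=` D &
    forall v, D v -> forall e : R, 0 < e -> exists2 c, C c & N (v - c) < e].

End NormedSet.

Definition metric_surjection (Y : normedModType K) (V : lmodType K)
    (D : set V) (N : V -> R) (S : Y -> V) : Prop :=
  range S = D /\
  forall y, N (S y) = inf [set rnorm y' | y' in [set y' | S y' = S y]].

(* The completion of [(V, N)] is unique up to isometric isomorphism; [Y] is
   a model of it, with canonical embedding [i]. *)
Definition is_completion (V : lmodType K) (N : V -> R) (Y : Banach)
    (i : {linear V -> Y}) : Prop :=
  (forall v, rnorm (i v) = N v) /\ dense (range i).

Definition finite_dimensional (V : lmodType K) : Prop :=
  exists (d : nat) (b : 'I_d -> V), forall v, exists c : 'I_d -> K,
    v = \sum_i c i *: b i.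

Record ideal (n : nat) := Ideal {
  ideal_mem :> forall (E : 'I_n -> Banach) (F : Banach),
    set ((forall i, E i) -> F);
  ideal_norm : forall (E : 'I_n -> Banach) (F : Banach),
    ((forall i, E i) -> F) -> R;
  ideal_continuous_multilinear : forall E F T,
    @ideal_mem E F T -> continuous_multilinear T;
  ideal_subspace : forall E F, subspace_set (@ideal_mem E F);
  ideal_norm_on : forall E F, norm_on (@ideal_mem E F) (@ideal_norm E F);
  ideal_complete : forall E F, complete_on (@ideal_mem E F) (@ideal_norm E F);
  ideal_comp : forall (X E : 'I_n -> Banach) (F Y : Banach)
      (P : forall i, {linear X i -> E i}) (S : {linear F -> Y})
      (T : (forall i, E i) -> F),
    (forall i, continuous (P i)) -> continuous S -> @ideal_mem E F T ->
    @ideal_mem X Y (fun x => S (T (fun i => P i (x i)))) /\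
    @ideal_norm X Y (fun x => S (T (fun i => P i (x i)))) <=
      op_norm S * @ideal_norm E F T * \prod_i op_norm (P i);
  ideal_prod :
    @ideal_mem (fun=> scalar_banach R k) (scalar_banach R k)
      (fun x => \prod_i (x i : K)) /\
    @ideal_norm (fun=> scalar_banach R k) (scalar_banach R k)
      (fun x => \prod_i (x i : K)) = 1
}.

End Notions.

Arguments ideal_norm {R k n} i E F _.

Section IdealProperties.
Variables (R : realType) (k : scalar_kind).
Local Notation K := (scalar_field R k).
Local Notation Banach := (completeNormedModType K).

(* The superspaces [G j] of [E j] are given by isometric embeddings [i j]. *)
Definition extendible (n : nat) (A : ideal R k n) : Prop :=
  forall (E G : 'I_n -> Banach) (F : Banach)
    (i : forall j, {linear E j -> G j}),
  (forall j x, `|i j x| = `|x|) ->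
  forall T, A E F T -> exists T', [/\ A G F T',
    forall x, T' (fun j => i j (x j)) = T x &
    ideal_norm A G F T' = ideal_norm A E F T].

Section Arens.
Variables (n : nat) (j : 'I_n).

Definition arens_fam (E : 'I_n -> Banach) (i : 'I_n) : Banach :=
  if i == j then (dual (dual (E i)) : Banach) else E i.

(* The coordinates of a point of [\prod_i arens_fam E i]: [arens_bidual x j]
   is its [j]-th coordinate, and [arens_base x i] its [i]-th one for
   [i != j]; the other values are [0]. *)
Definition arens_bidual (E : 'I_n -> Banach) (x : forall i, arens_fam E i)
    (i : 'I_n) : dual (dual (E i)) :=
  (if i == j as b return
      ((if b then (dual (dual (E i)) : Banach) else E i) -> dual (dual (E i)))
   then id else fun=> 0) (x i).

Definition arens_base (E : 'I_n -> Banach) (x : forall i, arens_fam E i)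
    (i : 'I_n) : E i :=
  (if i == j as b return
      ((if b then (dual (dual (E i)) : Banach) else E i) -> E i)
   then fun=> 0 else id) (x i).

Definition arens_slice (E : 'I_n -> Banach) (F : Banach)
    (T : (forall i, E i) -> F) (y : forall i, E i) (y' : dual F) : E j -> K :=
  fun z => y' (T (dfwith y j z)).

Lemma arens_slice_dual (E : 'I_n -> Banach) (F : Banach)
    (T : (forall i, E i) -> F) (y : forall i, E i) (y' : dual F) :
  continuous_multilinear T -> arens_slice T y y' \in @dual_pred R k (E j).
Proof.
move=> [mT cT]; apply/mem_set; split.
  by move=> a u v; rewrite /arens_slice mT dual_linear.
move=> z; apply: continuous_comp; last exact: dual_continuous.
apply: (@continuous_comp _ (prod_topology E)); last exact: cT.
exact: dfwith_continuous.
Qed.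

(* The value at [y'] of the [j]-th Arens extension of [T] at [x].  By
   [arens_slice_dual] the default value of [insubd] is never used when [T]
   is a continuous multilinear operator. *)
Definition arens_ext (E : 'I_n -> Banach) (F : Banach)
    (T : (forall i, E i) -> F) (x : forall i, arens_fam E i)
    (y' : dual F) : K :=
  arens_bidual x j (insubd (0 : dual (E j)) (arens_slice T (arens_base x) y')).

End Arens.

Definition arens_stable (n : nat) (A : ideal R k n) (F : Banach) : Prop :=
  forall (j : 'I_n) (E : 'I_n -> Banach) T, A E F T ->
  exists T', [/\ A (arens_fam j E) F T',
    forall x (y' : dual F), y' (T' x) = arens_ext T x y' &
    ideal_norm A (arens_fam j E) F T' = ideal_norm A E F T].

Section TensorNorm.
Variables (I : finType).
Variable alpha : forall E : I -> normedModType K, tensor E -> R.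

Record tensor_norm : Prop := TensorNorm {
  tensor_norm_on : forall E, norm_on [set: tensor E] (@alpha E);
  tensor_norm_ge : forall E (z : tensor E), injective_norm z <= alpha z;
  tensor_norm_le : forall E (z : tensor E), alpha z <= projective_norm z;
  tensor_norm_map : forall (E G : I -> normedModType K)
      (T : forall i, {linear E i -> G i}),
    (forall i, continuous (T i)) ->
    forall z, alpha (tensor_map T z) <= (\prod_i op_norm (T i)) * alpha z
}.

(* The subspaces [M j] of [E j] are given by isometric embeddings [i j]. *)
Definition finitely_generated : Prop :=
  forall (E : I -> normedModType K) (z : tensor E),
  alpha z = inf [set r | exists (M : I -> normedModType K)
      (i : forall j, {linear M j -> E j}) (w : tensor M),
    [/\ forall j, finite_dimensional (M j), forall j x, `|i j x| = `|x|,
        tensor_map i w = z & r = alpha w]].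

End TensorNorm.

(* Tensor products of order [n + 1] are indexed by [option 'I_n]; the last
   factor has index [None]. *)
Definition opt_fam (n : nat) (X : 'I_n -> normedModType K)
    (F : normedModType K) (o : option 'I_n) : normedModType K :=
  if o is Some i then X i else F.

Definition opt_point (n : nat) (X : 'I_n -> normedModType K)
    (F : normedModType K) (x : forall i, X i) (f : F) :
    forall o, opt_fam X F o :=
  fun o => match o with Some i => x i | None => f end.

(* The linear map sending x_1 (x) ... (x) x_n (x) f to the operator
   x_1(.)...x_n(.) f, where [p i] is a pairing of [X i] with [E i]. *)
Definition canonical_map (n : nat) (X E : 'I_n -> normedModType K)
    (F : normedModType K) (p : forall i, X i -> E i -> K)
    (Phi : tensor (opt_fam X F) -> (forall i, E i) -> F) : Prop :=
  linear Phi /\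
  forall x f, Phi (elem_tensor (opt_point x f)) =
    (fun y => (\prod_i p i (x i) (y i)) *: f).

Definition associated (n : nat) (A : ideal R k n)
    (alpha : forall E : option 'I_n -> normedModType K, tensor E -> R) : Prop :=
  forall (M : 'I_n -> Banach) (N : Banach),
  (forall i, finite_dimensional (M i)) -> finite_dimensional N ->
  exists Phi : tensor (opt_fam (fun i => dual (M i)) N) -> (forall i, M i) -> N,
    [/\ canonical_map (fun i (x' : dual (M i)) (x : M i) => x' x) Phi,
        range Phi = A M N &
        forall z, ideal_norm A M N (Phi z) = alpha _ z].

Definition l1_c0_pairing (J : choiceType) (a : l1 R k J) (x : c0 R k J) : K :=
  summability.sum (fun j => a j * x j).

(* [Psi] is determined by its values on elementary tensors: a metric
   surjection is continuous, and these tensors span a dense subspace. *)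
Definition radon_nikodym (n : nat) (A : ideal R k n)
    (alpha : forall E : option 'I_n -> normedModType K, tensor E -> R)
    (F : Banach) : Prop :=
  forall J : 'I_n -> choiceType,
  exists (Y : Banach)
    (i : {linear tensor (opt_fam (fun j => l1 R k (J j)) F) -> Y})
    (Psi : Y -> (forall j, c0 R k (J j)) -> F),
    [/\ is_completion (alpha _) i,
        linear Psi,
        canonical_map (fun j => @l1_c0_pairing (J j)) (fun z => Psi (i z)) &
        metric_surjection (A (fun j => c0 R k (J j)) F)
          (ideal_norm A (fun j => c0 R k (J j)) F) Psi].

End IdealProperties.

(* Main.v *)
Require Import Defs.
From HB Require Import structures.
From mathcomp Require Import all_boot all_order all_algebra.
From mathcomp Require Import complex.
From mathcomp Require Import all_classical all_reals all_analysis.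

Set Implicit Arguments.
Unset Strict Implicit.
Unset Printing Implicit Defensive.

Import Order.TTheory GRing.Theory Num.Theory numFieldNormedType.Exports.
Local Open Scope classical_set_scope.
Local Open Scope ring_scope.

(** Operators of finite type, the sums of products of functionals times vectors,
    form a separable set when [F] and the duals of the [E i] are separable, since
    the ideal norm of such a product is at most the product of the norms
    ([elem_op_mem]). So it is enough to approximate every operator of the ideal by
    operators of finite type in the ideal norm.

    On [c0] this is the Radon-Nikodym property: the operator is the image of an
    element of a completed tensor product, and the elementary tensors span a dense
    subspace of the latter ([c0_approximable]).

    To reduce to [c0], the variables are treated one at a time. Let [X] be the
    space in one of them, with separable dual, and let [G] be the space of bounded
    functions on the unit ball of that dual; [X] is isometric to a subspace of [G].
    Cover the unit ball by norm balls of radius [eps] around countably many points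
    [y m] and cut it into disjoint cells accordingly. A functional [mu] on [G]
    gives each cell a weight, and the sum over [m] of [y m x] times the weight of
    the [m]-th cell differs from [mu x] by at most [eps] times the norms of [mu]
    and [x] ([integral_evaluation]). The point is countable additivity, because
    [mu] is only a finitely additive measure; it holds since the norm balls are
    weak-star closed and the unit ball is weak-star compact
    ([variation_patches], [patch_cover]). In other words the inclusion of [X] in
    the bidual of [G] factors up to [eps] through the bidual of [c0], by the
    weak-star continuous extension of an operator from [c0] to the bidual of [G]
    ([c0_factor_exists]).

    Given an operator [T] of the ideal, extend it from [X] to [G] and then to the
    bidual of [G], by extendibility and Arens stability, and let [T0] be the
    composition with the operator that starts from [c0]. If [T0] is close to an
    operator of finite type, the Arens extension of the difference is small too,
    and composing it with the map from [X] to the bidual of [c0] shows that [T] is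
    close to an operator of finite type ([one_step]). The error of [eps] in the
    factorization contributes at most [eps] times the norm of [T]. *)

(** * Norms, bounded linear maps and ultrafilters *)

Section Scalars.
Variables (R : realType) (k : scalar_kind).
Local Notation K := (scalar_field R k).

Lemma rnormM (a b : K) : rnorm (a * b) = rnorm a * rnorm b.
Proof. exact: (@rnormZ R k K a b). Qed.

Lemma of_realN (a : R) : of_real k (- a) = - of_real k a.
Proof. by apply/eqP; rewrite -addr_eq0 -of_realD addNr of_real0. Qed.

Lemma rnormN (V : normedModType K) (x : V) : rnorm (- x) = rnorm x.
Proof. by rewrite /rnorm normrN. Qed.

Lemma rnormB (V : normedModType K) (x y : V) :
  rnorm (x - y) <= rnorm x + rnorm y.
Proof. by rewrite -(rnormN y) rnormD. Qed.

Lemma rnorm_gt0 (V : normedModType K) (x : V) : x != 0 -> 0 < rnorm x.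
Proof. by move=> x0; rewrite -(@of_real_lt R k) of_real0 rnormE normr_gt0. Qed.

Lemma rnorm_of_real (a : R) : 0 <= a -> rnorm (of_real k a : K) = a.
Proof.
move=> a0; apply: (can_inj (@of_realK R k)); rewrite rnormE ger0_norm//.
by rewrite -(@of_real0 R k) of_real_le.
Qed.

(** Turning the values of a functional by such factors makes their norms add up
    to a single value of the functional. *)
Lemma rotation (z : K) :
  exists c : K, rnorm c <= 1 /\ c * z = of_real k (rnorm z).
Proof.
have [->|z0] := eqVneq z 0.
  by exists 0; rewrite mulr0 rnorm0 of_real0.
exists (`|z| / z); split; last by rewrite mulfVK// rnormE.
rewrite rnormM rnormV.
have -> : rnorm (`|z| : K) = rnorm z by rewrite /rnorm normr_id.
by rewrite divff// gt_eqF// rnorm_gt0.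
Qed.

Lemma ultra_fmap (T T' : Type) (U : set_system T) (f : T -> T') :
  UltraFilter U -> UltraFilter (f @ U).
Proof.
move=> UU; split=> [|G GF sUG]; first exact: fmap_proper_filter.
apply/seteqP; split=> // A GA.
have [//|UA] := in_ultra_setVsetC (f @^-1` A) UU.
have GnA : G (~` A) by exact: sUG.
by have [x []] := filter_ex (filterI GA GnA).
Qed.

(** Bounded scalar functions converge along every ultrafilter: this is the only
    form of compactness used below, both for the weights of the cells and for
    the weak-star compactness of the dual unit ball. *)
Lemma ultra_cvg_real (T : Type) (U : set_system T) (f : T -> R) (M : R) :
  UltraFilter U -> (forall t, `|f t| <= M) -> cvg (f @ U).
Proof.
move=> UU fM; have := @segment_compact R (- M) M.
rewrite compact_ultra => /(_ (f @ U) (ultra_fmap f UU)) [|l [_ fl]].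
  by apply: (@filterE _ U) => t /=; rewrite in_itv /= -ler_norml.
by apply/cvg_ex; exists l.
Qed.

Lemma ultra_cvg_complex (T : Type) (U : set_system T)
    (f : T -> scalar_field R ComplexScalars) (M : R) :
  UltraFilter U -> (forall t, `|f t| <= M%:C%C) -> cvg (f @ U).
Proof.
move=> UU fM.
(* The real and the imaginary part converge separately. *)
have part (p : R[i] -> R) : (forall z, `|p z|%:C%C <= `|z|) -> cvg (p \o f @ U).
  move=> hp; apply: (@ultra_cvg_real _ _ _ M) => t /=.
  by rewrite -lecR; apply: le_trans (hp _) (fM t).
have /cvg_ex[/= a fa] : cvg (@complex.Re R \o f @ U).
  by apply: part => z; exact: normc_ge_Re.
have /cvg_ex[/= b fb] : cvg (@complex.Im R \o f @ U).
  apply: part => z; rewrite normc_def lecR -sqrtr_sqr.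
  by rewrite ler_wsqrtr// lerDr sqr_ge0.
apply: (cvgP ((a +i* b)%C : scalar_field R ComplexScalars)).
apply/cvgrPdist_le => e e0.
have eR : e = (complex.Re e)%:C%C by rewrite RRe_real// realE ltW.
have d0 : 0 < complex.Re e / 2 by rewrite divr_gt0// -ltcR -eR.
have /cvgrPdist_le/(_ _ d0) Ha := fa; have /cvgrPdist_le/(_ _ d0) Hb := fb.
have xab (y : R[i]) :
    (a +i* b)%C - y = ((a - complex.Re y) +i* (b - complex.Im y))%C by case: y.
have le2 (u v : R) : `|(u +i* v)%C| <= (`|u| + `|v|)%:C%C.
  rewrite normc_def lecR /= -[leRHS]ger0_norm ?addr_ge0// -sqrtr_sqr.
  rewrite ler_wsqrtr// sqrrD !real_normK ?num_real// lerD2r lerDl.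
  by rewrite mulrn_wge0// mulr_ge0.
near=> t; rewrite xab; apply: le_trans (le2 _ _) _; rewrite eR lecR.
rewrite (splitr (complex.Re e)).
by apply: lerD; near: t; [exact: Ha|exact: Hb].
Unshelve. all: by end_near. Qed.

Lemma ultra_cvg (T : Type) (U : set_system T) (f : T -> K) (M : R) :
  UltraFilter U -> (forall t, rnorm (f t) <= M) -> cvg (f @ U).
Proof.
move=> UU fM; have {}fM t : `|f t| <= of_real k M by rewrite -rnorm_le.
case: k f fM => f fM; first exact: ultra_cvg_real fM.
exact: ultra_cvg_complex fM.
Qed.

Lemma lim_rnorm_le (T : Type) (U : set_system T) (f : T -> K) (l : K) (M : R) :
  ProperFilter U -> f @ U --> l -> (\forall t \near U, rnorm (f t) <= M) ->
  rnorm l <= M.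
Proof.
move=> UU fl fM; rewrite rnorm_le; apply/ler_addgt0Pr => e e0.
have /cvgrPdist_le/(_ _ e0) H := fl.
have [t [ft lt]] := filter_ex (filterI fM H).
rewrite -[l](subrK (f t)) addrC; apply: le_trans (ler_normD _ _) _.
by rewrite lerD// -?rnorm_le.
Qed.

Lemma rnorm_cvg_le (T : Type) (U : set_system T) (f : T -> K) (l b : K) (M : R) :
  ProperFilter U -> f @ U --> l -> (\forall t \near U, rnorm (b - f t) <= M) ->
  rnorm (b - l) <= M.
Proof.
move=> UU fl; apply: (@lim_rnorm_le _ U (fun t => b - f t)).
by apply: cvgB => //; exact: cvg_cst.
Qed.

Lemma lin_bounded_cont (V W : normedModType K) (f : {linear V -> W}) (M : R) :
  (forall x, rnorm (f x) <= M * rnorm x) -> continuous f.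
Proof.
move=> fM; apply/linear_bounded_continuous/linear_boundedP.
exists (of_real k M); split.
  by rewrite realE -(@of_real0 R k) !of_real_le le_total.
move=> r Mr x; rewrite -rnormE.
apply: (@le_trans _ _ (of_real k (M * rnorm x))); first by rewrite of_real_le.
by rewrite of_realM rnormE ler_wpM2r// ltW.
Qed.

Lemma op_norm_le (V W : normedModType K) (f : V -> W) (M : R) :
  0 <= M -> (forall x, rnorm (f x) <= M * rnorm x) -> op_norm f <= M.
Proof.
move=> M0 fM; apply: sup_norm_le => // x /= x1; apply: le_trans (fM x) _.
by rewrite ler_piMr.
Qed.

End Scalars.

(** * Norming functionals *)

Section HahnBanach.
Variables (R : realType) (k : scalar_kind).
Local Notation K := (scalar_field R k).
Variable V : normedModType K.
Local Notation ofR := (@of_real R k).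

Definition sublinear (q : V -> R) : Prop :=
  (forall x y, q (x + y) <= q x + q y) /\
  (forall (t : R) x, 0 < t -> q (ofR t *: x) = t * q x).

Definition dominated (q : V -> R) : Prop := forall x, q x <= rnorm x.

Lemma of_realZ (a b : R) (x : V) : ofR a *: (ofR b *: x) = ofR (a * b) *: x.
Proof. by rewrite scalerA of_realM. Qed.

Lemma sublinear0 q : sublinear q -> q 0 = 0.
Proof.
move=> [_ qZ]; have := qZ 2 0 (ltr0n _ 2); rewrite scaler0 => h.
by apply/eqP; rewrite -[_ == _](inj_eq (addrI (q 0))) addr0 -mulr2n -mulr_natl -h.
Qed.

Lemma sublinearN q x : sublinear q -> - q (- x) <= q x.
Proof.
move=> qs; rewrite -subr_ge0 opprK -(sublinear0 qs).
by have := qs.1 x (- x); rewrite subrr.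
Qed.

Lemma dominated_lb q x : sublinear q -> dominated q -> - rnorm x <= q x.
Proof.
move=> qs qd; apply: le_trans (sublinearN x qs).
by rewrite lerN2 -[leRHS]rnormN qd.
Qed.

Lemma rnorm_sublinear : sublinear (@rnorm R k V).
Proof.
split; first exact: rnormD.
by move=> t x t0; rewrite rnormZ rnorm_of_real// ltW.
Qed.

(** A sublinear functional below [q] whose value at [- y] is at most [- q y].
    A minimal sublinear functional is fixed by all these slides, and this is
    what makes it additive. *)
Definition slide (q : V -> R) (y x : V) : R :=
  inf [set q (x + ofR t *: y) - t * q y | t in [set t : R | 0 <= t]].

Section Slide.
Variables (q : V -> R) (y : V).
Hypothesis qs : sublinear q.

Lemma sublinearZ0 (t : R) x : 0 <= t -> q (ofR t *: x) = t * q x.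
Proof.
rewrite le_eqVlt => /predU1P[<-|/qs.2//].
by rewrite of_real0 scale0r mul0r sublinear0.
Qed.

Lemma slide_lb x t : 0 <= t -> - q (- x) <= q (x + ofR t *: y) - t * q y.
Proof.
move=> t0; rewrite lerBrDr -sublinearZ0// addrC lerBlDr.
by have := qs.1 (x + ofR t *: y) (- x); rewrite addrAC subrr add0r.
Qed.

Lemma slide_has_inf x :
  has_inf [set q (x + ofR t *: y) - t * q y | t in [set t : R | 0 <= t]].
Proof.
split; first by exists (q (x + ofR 0 *: y) - 0 * q y), 0 => //=.
by exists (- q (- x)) => _ [t /= t0 <-]; exact: slide_lb.
Qed.

Lemma slide_le x t : 0 <= t -> slide q y x <= q (x + ofR t *: y) - t * q y.
Proof. by move=> t0; apply: ge_inf; [exact: (slide_has_inf x).2|exists t]. Qed.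

Lemma slide_le_self x : slide q y x <= q x.
Proof.
by have := slide_le x (lexx 0); rewrite of_real0 scale0r addr0 mul0r subr0.
Qed.

Lemma slide_ge x m :
  (forall t, 0 <= t -> m <= q (x + ofR t *: y) - t * q y) -> m <= slide q y x.
Proof.
move=> h; apply: lb_le_inf; first exact: (slide_has_inf x).1.
by move=> _ [t /= /h t0 <-].
Qed.

Lemma slideN : slide q y (- y) <= - q y.
Proof.
have := slide_le (- y) ler01.
by rewrite of_real1 scale1r addNr sublinear0// mul1r add0r.
Qed.

Lemma slide_sublinear : sublinear (slide q y).
Proof.
split=> [x x'|t x t0].
  rewrite -lerBlDl; apply: slide_ge => s s0.
  rewrite lerBlDr -lerBlDl; apply: slide_ge => t t0; rewrite lerBlDl.
  apply: le_trans (slide_le _ (addr_ge0 s0 t0)) _.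
  rewrite mulrDl opprD addrACA lerD2r addrC.
  have := qs.1 (x + ofR t *: y) (x' + ofR s *: y).
  by rewrite addrACA -scalerDl -of_realD (addrC t).
have le (u : R) z : 0 < u -> slide q y (ofR u *: z) <= u * slide q y z.
  move=> u0; rewrite -ler_pdivrMl//; apply: slide_ge => s s0.
  rewrite ler_pdivrMl//.
  apply: le_trans (slide_le _ (mulr_ge0 (ltW u0) s0)) _.
  by rewrite -of_realZ -scalerDr qs.2// mulrBr mulrA.
apply/eqP; rewrite eq_le le//=.
have ti0 : 0 < t^-1 by rewrite invr_gt0.
rewrite -ler_pdivlMl//; have := le _ (ofR t *: x) ti0.
by rewrite of_realZ mulVf ?gt_eqF// of_real1 scale1r.
Qed.

End Slide.

(** Zorn's lemma applies because a sublinear functional below the norm is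
    bounded below by minus the norm, so that the pointwise infimum of a chain is
    finite. *)
Lemma minimal_sublinear q : sublinear q -> dominated q ->
  exists f, [/\ sublinear f, forall x, f x <= q x &
    forall g, sublinear g -> (forall x, g x <= f x) -> g = f].
Proof.
move=> qs qd; pose T := {f : V -> R | sublinear f /\ forall x, f x <= q x}.
pose le (f g : T) : bool := `[< forall x, sval g x <= sval f x >].
have [||||[f [fs fq]] fmin] := @Zorn T le.
- by move=> f; apply/asboolP.
- move=> f g h /asboolP fg /asboolP gh; apply/asboolP => x.
  exact: le_trans (gh x) (fg x).
- move=> [f Pf] [g Pg] /asboolP /= fg /asboolP /= gf; apply: eq_exist.
  by apply/funext => x; apply/eqP; rewrite eq_le fg gf.
- move=> C Ctot; have [[c0 Cc0]|C0] := pselect (C !=set0); last first.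
    exists (exist _ q (conj qs (fun x => lexx (q x)))) => f Cf.
    by exfalso; apply: C0; exists f.
  pose m x := inf [set sval f x | f in C].
  have hinf x : has_inf [set sval f x | f in C].
    split; first by exists (sval c0 x), c0.
    exists (- rnorm x) => _ [f _ <-]; case: f => f [fs fq] /=.
    by apply: dominated_lb => // z; exact: le_trans (fq z) (qd z).
  have m_le f x : C f -> m x <= sval f x.
    by move=> Cf; apply: ge_inf; [exact: (hinf x).2|exists f].
  have m_ge x a : (forall f, C f -> a <= sval f x) -> a <= m x.
    by move=> h; apply: lb_le_inf; [exact: (hinf x).1|move=> _ [f /h ? <-]].
  have ms : sublinear m.
    split=> [x y|t x t0].
      rewrite -lerBlDl; apply: (m_ge _ _) => f Cf; rewrite lerBlDr -lerBlDl.
      apply: (m_ge _ _) => g Cg; rewrite lerBlDl.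
      have [/asboolP fg|/asboolP gf] := Ctot _ _ Cf Cg.
        apply: le_trans (m_le g _ Cg) _.
        by apply: le_trans ((svalP g).1.1 _ _) _; rewrite addrC lerD2r.
      apply: le_trans (m_le f _ Cf) _.
      by apply: le_trans ((svalP f).1.1 _ _) _; rewrite addrC lerD2l.
    have mle (u : R) z : 0 < u -> m (ofR u *: z) <= u * m z.
      move=> u0; rewrite -ler_pdivrMl//; apply: (m_ge _ _) => f Cf.
      rewrite ler_pdivrMl// -(svalP f).1.2//; exact: m_le.
    apply/eqP; rewrite eq_le mle//=.
    have ti0 : 0 < t^-1 by rewrite invr_gt0.
    rewrite -ler_pdivlMl//; have := mle _ (ofR t *: x) ti0.
    by rewrite of_realZ mulVf ?gt_eqF// of_real1 scale1r.
  have mq x : m x <= q x by apply: le_trans (m_le c0 x Cc0) _; exact: (svalP c0).2.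
  by exists (exist _ m (conj ms mq)) => f Cf; apply/asboolP => x; exact: m_le.
exists f; split=> // g gs gf.
have gq x : g x <= q x by exact: le_trans (gf x) (fq x).
have /= := fmin (exist _ g (conj gs gq)); move=> /(_ _)/(congr1 sval); apply.
exact/asboolP.
Qed.

(** A minimal functional below the norm slid along [x]: the slide forces its
    value at [- x] down to [- rnorm x]. *)
Lemma real_norming (x : V) : exists f : V -> R,
  [/\ forall y z, f (y + z) = f y + f z, forall (t : R) y, f (ofR t *: y) = t * f y,
      forall y, `|f y| <= rnorm y & f x = rnorm x].
Proof.
pose q := slide (@rnorm R k V) x.
have qs : sublinear q := slide_sublinear x rnorm_sublinear.
have qd : dominated q := slide_le_self x rnorm_sublinear.
have [f [fs fq fmin]] := minimal_sublinear qs qd.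
have fd : dominated f by move=> y; exact: le_trans (fq y) (qd y).
have fslide y : slide f y = f.
  by apply: fmin; [exact: slide_sublinear|exact: slide_le_self].
have fD y z : f (y + z) = f y + f z.
  apply/eqP; rewrite eq_le fs.1/= -lerBrDr.
  rewrite -[in leLHS](fslide z); have := slide_le z fs y ler01.
  by rewrite of_real1 scale1r mul1r.
have fN y : f (- y) = - f y.
  by apply/eqP; rewrite -subr_eq0 opprK -fD addNr (sublinear0 fs).
exists f; split=> //.
- move=> t y; have [t0|t0] := leP 0 t; first exact: sublinearZ0.
  rewrite -[t]opprK -[f y]opprK mulrNN -fN -(sublinearZ0 fs) ?oppr_ge0 ?ltW//.
  by rewrite of_realN scaleNr scalerN.
- move=> y; rewrite ler_norml fd andbT; exact: dominated_lb.
- apply/eqP; rewrite eq_le fd/= -[f x]opprK -fN lerNr.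
  exact: le_trans (fq _) (slideN _ rnorm_sublinear).
Qed.

Lemma bounded_dual (f : V -> K) (M : R) : linear f ->
  (forall x, rnorm (f x) <= M * rnorm x) -> {g : dual V | g =1 f}.
Proof.
move=> lf fM.
pose L : {linear V -> K} := HB.pack f (GRing.isLinear.Build K V K *%R f lf).
have fP : f \in @dual_pred R k V.
  rewrite inE; split=> //.
  exact: (@lin_bounded_cont R k V K L M).
by exists (Dual fP).
Qed.

End HahnBanach.

Section Complexification.
Variable (R : realType).
Local Notation C := (scalar_field R ComplexScalars).
Variables (V : normedModType C) (f : V -> R).
Hypothesis fD : forall y z, f (y + z) = f y + f z.
Hypothesis fZ : forall (t : R) y, f (of_real ComplexScalars t *: y) = t * f y.
Hypothesis fn : forall y, `|f y| <= rnorm y.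

(** The complex linear functional whose real part is [f]. *)
Definition complexify (y : V) : C := (f y -i* f (('i%C : C) *: y))%C.

Lemma complexify_linear : linear complexify.
Proof.
move=> c y z; rewrite /complexify; pose i : C := 'i%C.
have ii : i * i = -1 by rewrite /i -expr2 sqr_i.
have fN w : f (- w) = - f w.
  by rewrite -scaleN1r -[- f w]mulN1r -fZ; congr (f (_ *: _)); rewrite /= rmorphN1.
have cE : c = of_real ComplexScalars (complex.Re c)
            + of_real ComplexScalars (complex.Im c) * i.
  by rewrite /= [LHS]complexE mulrC.
have fc w : f (c *: w) = complex.Re c * f w + complex.Im c * f (i *: w).
  by rewrite {1}cE scalerDl fD fZ -scalerA fZ.
rewrite -/i scalerDr !fD (scalerA i) (mulrC i) -scalerA !fc.
rewrite scalerA ii scaleN1r fN.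
case: c {cE fc} => a b /=.
apply/eqP; rewrite eq_complex /=; apply/andP; split; apply/eqP => /=.
  by rewrite mulrN opprK.
by rewrite !mulrN !opprD opprK.
Qed.

(** After a rotation of [y] the value is real, hence a value of [f]. *)
Lemma complexify_le y : rnorm (complexify y) <= rnorm y.
Proof.
have [c [c1 cz]] := rotation (complexify y).
have := complexify_linear c y 0; rewrite !addr0.
have -> : complexify 0 = 0.
  have := complexify_linear 1 0 0; rewrite !scale1r addr0.
  move=> /(congr1 (fun z => z - complexify 0)).
  by rewrite subrr addrK.
rewrite addr0 -[c *: complexify y]/(c * complexify y) cz.
move=> /(congr1 (@complex.Re R)) /= <-.
apply: le_trans (ler_norm _) _; apply: le_trans (fn _) _.
by rewrite rnormZ ler_piMl ?rnorm_ge0.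
Qed.

Lemma complexify_norming x : f x = rnorm x ->
  complexify x = of_real ComplexScalars (rnorm x).
Proof.
move=> fx; have := complexify_le x; rewrite rnorm_le /complexify fx.
rewrite normc_def /= lecR => le.
have /eqP : f (('i%C : C) *: x) ^+ 2 = 0.
  apply/eqP; rewrite eq_le sqr_ge0 andbT -sqrrN -(lerD2l (rnorm x ^+ 2)) addr0.
  rewrite -(@ler_sqrt _ _ (rnorm x ^+ 2)) ?addr_ge0 ?sqr_ge0//.
  by rewrite [leRHS]sqrtr_sqr ger0_norm ?rnorm_ge0.
by rewrite expf_eq0 /= => /eqP ->; rewrite oppr0.
Qed.
End Complexification.

Theorem norming (R : realType) (k : scalar_kind)
    (V : normedModType (scalar_field R k)) (x : V) :
  exists f : dual V, rnorm f <= 1 /\ f x = of_real k (rnorm x).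
Proof.
suff [g [lg gn gx]] : exists g : V -> scalar_field R k, [/\ linear g,
    forall y, rnorm (g y) <= rnorm y & g x = of_real k (rnorm x)].
  have gn1 y : rnorm (g y) <= 1 * rnorm y by rewrite mul1r.
  have [h hg] := bounded_dual lg gn1.
  exists h; split; last by rewrite hg.
  rewrite dual_normE; apply: op_norm_le => // y; rewrite hg; exact: gn1.
have [f [fD fZ fn fx]] := real_norming x.
case: k V x f fD fZ fn fx => V x f fD fZ fn fx; last first.
  exists (complexify f); split; first exact: complexify_linear.
    exact: complexify_le.
  exact: complexify_norming.
by exists f; split=> // a y z; rewrite fD fZ.
Qed.

Section Separation.
Variables (R : realType) (k : scalar_kind).
Local Notation K := (scalar_field R k).
Variable V : normedModType K.

Lemma dual_separates (x y : V) : (forall f : dual V, f x = f y) -> x = y.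
Proof.
move=> xy; apply/eqP; rewrite -subr_eq0; apply/eqP/rnorm0_eq0.
have [f [_ fE]] := norming (x - y).
by apply: (can_inj (@of_realK R k)); rewrite -fE linearB /= xy subrr of_real0.
Qed.

Lemma dual_le (f : dual V) (x : V) (M : R) :
  rnorm f <= M -> rnorm (f x) <= M * rnorm x.
Proof.
move=> fM; apply: le_trans (dual_op_le f x) _.
by rewrite ler_wpM2r ?rnorm_ge0// -dual_normE.
Qed.

Lemma dual_norm_le (f : dual V) (M : R) : 0 <= M ->
  (forall x, rnorm (f x) <= M * rnorm x) -> rnorm f <= M.
Proof. by move=> M0 fM; rewrite dual_normE; exact: op_norm_le. Qed.

Lemma linear_map (W : normedModType K) (f : V -> W) :
  linear f -> {g : {linear V -> W} | g =1 f}.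
Proof.
move=> lf.
pose L : {linear V -> W} := HB.pack f (GRing.isLinear.Build K V W *:%R f lf).
by exists L.
Qed.

End Separation.

(** * Bounded functions and the variation of a functional *)

Section BoundedFunctions.
Variables (R : realType) (k : scalar_kind) (S : Type).
Local Notation K := (scalar_field R k).

Definition linf_pred : {pred S -> K} :=
  mem [set g : S -> K | bounded_over [set: S] g].

Record linf := Linf { linf_fun :> S -> K; _ : linf_fun \in linf_pred }.

HB.instance Definition _ := [isSub for linf_fun].
HB.instance Definition _ := [Choice of linf by <:].

Lemma linf_submod_closed : submod_closed linf_pred.
Proof.
split; first by rewrite inE; exists 0 => s _; rewrite rnorm0.
move=> a f g; rewrite !inE => -[M fM] [N gN].
exists (rnorm a * M + N) => s _; apply: le_trans (rnormD _ _) _.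
by rewrite lerD ?gN// rnormM ler_wpM2l ?rnorm_ge0 ?fM.
Qed.

HB.instance Definition _ :=
  GRing.isSubmodClosed.Build K (S -> K) linf_pred linf_submod_closed.
HB.instance Definition _ := [SubChoice_isSubLmodule of linf by <:].

Lemma linf_bounded (g : linf) : bounded_over [set: S] g.
Proof. by case: g => g /=; rewrite inE. Qed.

Let linf_norm (g : linf) : K := of_real k (sup_norm [set: S] g).

Let linf_normD f g : linf_norm (f + g) <= linf_norm f + linf_norm g.
Proof.
rewrite /linf_norm -of_realD of_real_le.
by apply: sup_normD; exact: linf_bounded.
Qed.

Let linf_normZ (a : K) g : linf_norm (a *: g) = `|a| * linf_norm g.
Proof.
rewrite /linf_norm -rnormE -of_realM; congr of_real.
by apply: sup_normZ; exact: linf_bounded.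
Qed.

Let linf_norm0_eq0 g : linf_norm g = 0 -> g = 0.
Proof.
rewrite /linf_norm -(of_real0 R k) => /(can_inj (@of_realK R k)) g0.
apply/val_inj/funext => s; apply: rnorm0_eq0; apply/eqP.
rewrite eq_le rnorm_ge0 andbT -g0.
by apply: sup_norm_ub => //; exact: linf_bounded.
Qed.

HB.instance Definition _ :=
  Lmodule_isNormed.Build K linf linf_normD linf_normZ linf_norm0_eq0.

Lemma linf_normE (g : linf) : rnorm g = sup_norm [set: S] g.
Proof. exact: of_realK. Qed.

Lemma linf_le (g : linf) s : rnorm (g s) <= rnorm g.
Proof. by rewrite linf_normE; apply: sup_norm_ub => //; exact: linf_bounded. Qed.

Lemma linf_norm_le (g : linf) (M : R) :
  0 <= M -> (forall s, rnorm (g s) <= M) -> rnorm g <= M.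
Proof. by move=> M0 gM; rewrite linf_normE; exact: sup_norm_le. Qed.

Lemma linf_complete (F : set_system linf) :
  ProperFilter F -> cauchy F -> cvg F.
Proof.
move=> FF Fc.
have evw (f g : linf) (s : S) : `|f s - g s| <= `|f - g| * 1.
  rewrite mulr1 -!rnormE of_real_le.
  exact: (linf_le (f - g)).
have [g [_ ug]] := cauchy_pointwise evw (fun=> ler01) FF Fc.
have gP : g \in linf_pred.
  rewrite inE; have [f f1] := filter_ex (ug 1 ltr01).
  exists (1 + rnorm f) => s _; rewrite -[g s](subrK (f s)).
  apply: le_trans (rnormD _ _) _; rewrite lerD ?linf_le// rnorm_le of_real1.
  by have := f1 s; rewrite mulr1.
apply/cvg_ex; exists (Linf gP); apply/cvgrPdist_le => e e0.
apply: filterS (ug e e0) => f fe.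
rewrite -rnormE -(re_scalarK (ltW e0)) of_real_le; apply: linf_norm_le.
  by rewrite -(@of_real_le R k) of_real0 (re_scalarK (ltW e0)) ltW.
move=> s; rewrite rnorm_le (re_scalarK (ltW e0)).
by have := fe s; rewrite mulr1.
Qed.

HB.instance Definition _ := Uniform_isComplete.Build linf linf_complete.

Lemma linf_mk (f : S -> K) (M : R) :
  (forall s, rnorm (f s) <= M) -> {g : linf | g =1 f}.
Proof.
move=> fM; have fP : f \in linf_pred by rewrite inE; exists M => s _; exact: fM.
by exists (Linf fP).
Qed.

Lemma linf_ext (f g : linf) : f =1 g -> f = g.
Proof. by move=> fg; apply/val_inj/funext. Qed.

Lemma linf_addE (f g : linf) s : (f + g) s = f s + g s. Proof. by []. Qed.
Lemma linf_scaleE (a : K) (g : linf) s : (a *: g) s = a * g s. Proof. by []. Qed.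
Lemma linf_subE (f g : linf) s : (f - g) s = f s - g s. Proof. by []. Qed.
Lemma restr_subproof (A : set S) (g : linf) s :
  rnorm (if s \in A then g s else 0) <= rnorm g.
Proof. by case: ifP => _; rewrite ?linf_le// rnorm0 rnorm_ge0. Qed.

Definition restr (A : set S) (g : linf) : linf :=
  sval (linf_mk (restr_subproof A g)).

Lemma restrE A g s : restr A g s = if s \in A then g s else 0.
Proof. by rewrite /restr; case: linf_mk => /= h ->. Qed.

Section Variation.
Variable mu : dual linf.

Definition below (A : set S) : set linf :=
  [set g | forall s, rnorm (g s) <= (s \in A)%:R].

(** The total variation of [mu] on [A]. A functional on all bounded functions
    is a finitely additive measure, so that countable additivity has to be
    proved separately for the sets that need it. *)
Definition variation (A : set S) : R := sup [set rnorm (mu g) | g in below A].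

Lemma below0 A : below A 0.
Proof. by move=> s; rewrite rnorm0 ler0n. Qed.

Lemma belowZ A (c : K) g : rnorm c <= 1 -> below A g -> below A (c *: g).
Proof.
move=> c1 gA s; rewrite linf_scaleE rnormM.
by apply: le_trans (gA s); rewrite ler_piMl ?rnorm_ge0.
Qed.

Lemma below_norm A g : below A g -> rnorm g <= 1.
Proof.
move=> gA; apply: linf_norm_le => // s; apply: le_trans (gA s) _.
by case: (s \in A); rewrite ?ler01.
Qed.

Lemma variation_has_sup A : has_sup [set rnorm (mu g) | g in below A].
Proof.
split; first by exists (rnorm (mu 0)), 0; first exact: below0.
exists (rnorm mu) => _ [g gA <-]; apply: le_trans (dual_op_le mu g) _.
by rewrite -dual_normE ler_piMr ?rnorm_ge0//; exact: below_norm gA.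
Qed.

Lemma le_variation A g : below A g -> rnorm (mu g) <= variation A.
Proof.
by move=> gA; apply: ub_le_sup; [exact: (variation_has_sup A).2|exists g].
Qed.

Lemma variation_le A (M : R) :
  (forall g, below A g -> rnorm (mu g) <= M) -> variation A <= M.
Proof.
move=> h; apply: ge_sup; first exact: (variation_has_sup A).1.
by move=> _ [g /h gM <-].
Qed.

Lemma variation_ge0 A : 0 <= variation A.
Proof. by apply: le_trans (rnorm_ge0 (mu 0)) (le_variation (below0 A)). Qed.

Lemma variation_mono A B : A `<=` B -> variation A <= variation B.
Proof.
move=> AB; apply: variation_le => g gA; apply: le_variation => s.
apply: le_trans (gA s) _; rewrite ler_nat.
by case: (boolP (s \in A)) => // /set_mem/AB/mem_set ->.
Qed.

Lemma variation_scale A (g : linf) (M : R) : 0 <= M ->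
  (forall s, rnorm (g s) <= M * (s \in A)%:R) ->
  rnorm (mu g) <= M * variation A.
Proof.
rewrite le_eqVlt => /predU1P[<- g0|M0 gM].
  have -> : g = 0.
    apply: linf_ext => s; apply: rnorm0_eq0; apply/eqP.
    by rewrite eq_le rnorm_ge0 andbT -(mul0r (s \in A)%:R) g0.
  by rewrite linear0 rnorm0 mul0r.
rewrite mulrC -ler_pdivrMr// mulrC.
have <- : rnorm (of_real k M^-1 : K) = M^-1.
  by rewrite rnorm_of_real// invr_ge0 ltW.
rewrite -rnormM -[_ * _]/(_ *: mu g) -linearZ /=; apply: le_variation => s.
rewrite linf_scaleE rnormM rnorm_of_real ?invr_ge0 ?(ltW M0)//.
by rewrite ler_pdivrMl.
Qed.

Lemma variation_subadd A B : variation (A `|` B) <= variation A + variation B.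
Proof.
apply: variation_le => g gAB.
have -> : g = restr A g + restr (~` A) g.
  apply: linf_ext => s; rewrite linf_addE !restrE in_setC.
  by case: (s \in A); rewrite ?addr0 ?add0r.
rewrite linearD; apply: le_trans (rnormD _ _) _; apply: lerD.
  apply: le_variation => s; rewrite restrE; case: ifPn => sA.
    by apply: le_trans (gAB s) _; rewrite lern1 leq_b1.
  by rewrite rnorm0.
apply: le_variation => s; rewrite restrE in_setC; case: ifPn => sA.
  by apply: le_trans (gAB s) _; rewrite in_setU (negbTE sA).
by rewrite rnorm0 ler0n.
Qed.

(** Rotations of two functions with disjoint supports make the two values add
    up, while their sum still lies below the indicator of the union. *)
Lemma variation_superadd A B : A `&` B = set0 ->
  variation A + variation B <= variation (A `|` B).
Proof.
move=> AB0; rewrite -lerBrDr; apply: variation_le => g gA.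
rewrite lerBrDr -lerBrDl; apply: variation_le => h hB; rewrite lerBrDl.
have [c [c1 cg]] := rotation (mu g); have [d [d1 dh]] := rotation (mu h).
have -> : rnorm (mu g) + rnorm (mu h) = rnorm (mu (c *: g + d *: h)).
  rewrite linearD !linearZ /= cg dh.
  by rewrite -of_realD rnorm_of_real// addr_ge0 ?rnorm_ge0.
apply: le_variation => s; rewrite linf_addE in_setU.
apply: le_trans (rnormD _ _) _.
apply: le_trans (lerD (belowZ c1 gA s) (belowZ d1 hB s)) _.
have : ~~ ((s \in A) && (s \in B)).
  by rewrite -in_setI AB0 in_set0.
by case: (s \in A); case: (s \in B) => //= _; rewrite ?addr0 ?add0r.
Qed.

End Variation.
End BoundedFunctions.

(** * Ultrafilter limits and maps into biduals *)

Section UltraLimits.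
Variables (R : realType) (k : scalar_kind) (T : Type) (U : set_system T).
Hypothesis UU : UltraFilter U.
Local Notation K := (scalar_field R k).

Definition bdd (f : T -> K) : Prop := exists M : R, forall t, rnorm (f t) <= M.

Definition ulim (f : T -> K) : K := lim (f @ U).

Lemma ulim_cvg f : bdd f -> f @ U --> ulim f.
Proof. by move=> [M fM]; exact: ultra_cvg fM. Qed.

Lemma ulim_eq f (l : K) : f @ U --> l -> ulim f = l.
Proof. by move=> fl; apply: cvg_lim => //; exact: norm_hausdorff. Qed.

Lemma ulim_linear (a : K) f g : bdd f -> bdd g ->
  ulim (fun t => a * f t + g t) = a * ulim f + ulim g.
Proof.
move=> bf bg; apply: ulim_eq; apply: cvgD; last exact: ulim_cvg.
by apply: cvgM; [exact: cvg_cst|exact: ulim_cvg].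
Qed.

Lemma ulim_near f (l : K) : (\forall t \near U, f t = l) -> ulim f = l.
Proof.
move=> fl; apply: ulim_eq; apply: cvg_near_cst.
exact: filterS fl.
Qed.

Lemma ulim_le f (M : R) : bdd f -> (\forall t \near U, rnorm (f t) <= M) ->
  rnorm (ulim f) <= M.
Proof. by move=> bf; apply: lim_rnorm_le; exact: ulim_cvg. Qed.

Lemma ulim_sub_le f (b : K) (M : R) : bdd f ->
  (\forall t \near U, rnorm (b - f t) <= M) -> rnorm (b - ulim f) <= M.
Proof. by move=> bf; apply: rnorm_cvg_le; exact: ulim_cvg. Qed.

Lemma ulim_sum f (n : nat) (a : nat -> K) (g : nat -> T -> K) :
  (forall m, bdd (g m)) -> (forall t, f t = \sum_(m < n) a m * g m t) ->
  f @ U --> \sum_(m < n) a m * ulim (g m).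
Proof.
move=> bg fE; have -> : f = \sum_(m < n) (fun t => a m * g m t).
  by apply/funext => t; rewrite fE fct_sumE.
elim: n {fE} => [|n IHn]; first by rewrite !big_ord0; exact: cvg_cst.
rewrite !big_ord_recr; apply: cvgD => //.
by apply: cvgM; [exact: cvg_cst|exact: ulim_cvg].
Qed.

Lemma near_all (I : eqType) (r : seq I) (P : I -> T -> Prop) :
  (forall i, i \in r -> \forall t \near U, P i t) ->
  \forall t \near U, forall i, i \in r -> P i t.
Proof.
elim: r => [|i r IHr] h; first exact: filterE.
have h1 := h i (mem_head _ _).
have {}/IHr h2 : forall j, j \in r -> \forall t \near U, P j t.
  by move=> j jr; apply: h; rewrite inE jr orbT.
apply: filterS2 h1 h2 => t Pi Pr j; rewrite inE => /predU1P[->//|]; exact: Pr.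
Qed.

End UltraLimits.

Section BidualMaps.
Variables (R : realType) (k : scalar_kind).
Local Notation K := (scalar_field R k).
Variables (Z G : normedModType K).

Lemma bidual_map (L : Z -> dual G -> K) (C : R) : 0 <= C ->
  (forall z, linear (L z)) -> (forall mu, linear (L^~ mu)) ->
  (forall z mu, rnorm (L z mu) <= C * rnorm z * rnorm mu) ->
  exists P : {linear Z -> dual (dual G)},
    (forall z mu, P z mu = L z mu) /\ forall z, rnorm (P z) <= C * rnorm z.
Proof.
move=> C0 L1 L2 LC.
have /(_ _)/cid ex z : exists f : dual (dual G), forall mu, f mu = L z mu.
  have [f fE] := bounded_dual (L1 z) (LC z).
  by exists f.
pose P z := sval (ex z).
have PE z mu : P z mu = L z mu := svalP (ex z) mu.
have Plin : linear P.
  move=> a z w; apply/val_inj/funext => mu.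
  rewrite -[LHS]/(P (a *: z + w) mu) -[RHS]/(a *: P z mu + P w mu).
  by rewrite !PE L2.
have [Q QE] := linear_map Plin.
exists Q; split=> [z mu|z]; first by rewrite QE PE.
by apply: dual_norm_le => [|mu]; rewrite ?mulr_ge0 ?rnorm_ge0// QE PE.
Qed.

End BidualMaps.

(** * Cells of the dual unit ball *)

Section Cells.
Variables (R : realType) (k : scalar_kind).
Local Notation K := (scalar_field R k).
Variable X : normedModType K.

Definition dual_ball : Type := {f : dual X | rnorm f <= 1}.

Local Notation G := (linf R k dual_ball).

(** The superspace of [X] used below: all bounded functions on the dual unit
    ball. It is isometric by the existence of norming functionals. *)
Lemma evaluation_exists :
  exists e : {linear X -> G}, (forall x s, e x s = sval s x) /\
    forall x, rnorm (e x) = rnorm x.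
Proof.
have sle (x : X) (s : dual_ball) : rnorm (sval s x) <= rnorm x.
  by rewrite -[leRHS]mul1r; apply: dual_le; exact: (svalP s).
pose e x := sval (linf_mk (sle x)).
have eE x s : e x s = sval s x by rewrite /e; case: linf_mk => g /= ->.
have elin : linear e.
  by move=> a x y; apply: linf_ext => s; rewrite linf_addE linf_scaleE !eE linearP.
have [i iE] := linear_map elin.
exists i; split=> [x s|x]; first by rewrite iE eE.
apply/eqP; rewrite eq_le; apply/andP; split.
  by apply: linf_norm_le => [|s]; rewrite ?rnorm_ge0// iE eE.
have [f [f1 fx]] := norming x.
have := linf_le (i x) (exist _ f f1).
by rewrite iE eE /= fx rnorm_of_real ?rnorm_ge0.
Qed.

Variables (y : nat -> dual X) (eps : R).
Hypothesis y2 : forall m, rnorm (y m) <= 2.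
Hypothesis eps0 : 0 <= eps.
Variables (V : set_system nat) (W : set_system (seq X)).
Hypothesis UV : UltraFilter V.
Hypothesis UW : UltraFilter W.
Hypothesis Vinf : forall M0, \forall M \near V, (M0 <= M)%N.
Hypothesis Winf : forall x : X, \forall L \near W, x \in L.

(** The points of the dual unit ball that look [eps]-close to [y m] when tested
    on the finitely many vectors in [L]. They are weak-star neighbourhoods of the
    points at norm distance less than [eps] from [y m], and for growing [L] they
    decrease to the points at distance at most [eps]. *)
Definition patch (m : nat) (L : seq X) : set dual_ball :=
  [set s | forall x, x \in L -> rnorm ((sval s - y m) x) <= eps * rnorm x].

(** Disjointification of the patches. *)
Definition cell (m : nat) (L : seq X) : set dual_ball :=
  [set s | patch m L s /\ forall m', (m' < m)%N -> ~ patch m' L s].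

Lemma ind_subproof (A : set dual_ball) s :
  rnorm (if s \in A then 1 else 0 : K) <= 1.
Proof. by case: ifP; rewrite ?rnorm1 ?rnorm0. Qed.

Definition ind (A : set dual_ball) : G := sval (linf_mk (ind_subproof A)).

Lemma indE A s : ind A s = if s \in A then 1 else 0.
Proof. by rewrite /ind; case: linf_mk => /= g ->. Qed.

Definition step (a : nat -> K) (M : nat) (L : seq X) : G :=
  \sum_(m < M) a m *: ind (cell m L).

(** The cells are disjoint: at each point at most one term of the step function
    survives, and none does exactly off all the patches. *)
Lemma stepE a M L s :
  (exists m, [/\ (m < M)%N, patch m L s & step a M L s = a m]) \/
  ((forall m, (m < M)%N -> ~ patch m L s) /\ step a M L s = 0).
Proof.
elim: M => [|M [[m [mM sm sE]]|[sM sE]]].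
- by right; split => //; rewrite /step big_ord0.
- left; exists m; split; rewrite ?(ltnW mM)//; first exact: leqW.
  rewrite /step big_ord_recr linf_addE linf_scaleE indE -/(step a M L) sE.
  case: ifPn => [|_]; last by rewrite mulr0 addr0.
  by move=> /set_mem[_ /(_ m mM)].
- have sS : step a M.+1 L s = a M * (if s \in cell M L then 1 else 0).
    rewrite /step big_ord_recr linf_addE linf_scaleE indE -/(step a M L) sE.
    exact: add0r.
  have [sM'|sM'] := pselect (patch M L s); [left|right].
    by exists M; split=> //; rewrite sS mem_set ?mulr1//; split.
  split; last by rewrite sS memNset ?mulr0// => -[].
  by move=> m; rewrite ltnS leq_eqVlt => /predU1P[->//|]; exact: sM.
Qed.

Lemma step_le a (c : R) M L s : 0 <= c -> (forall m, rnorm (a m) <= c) ->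
  rnorm (step a M L s) <= c.
Proof.
move=> c0 ac; have [[m [_ _ ->]]//|[_ ->]] := stepE a M L s.
by rewrite rnorm0.
Qed.

Section Mu.
Variable mu : dual G.

(** The weight that [mu] gives to the [m]-th cell in the limit of finer and finer
    tests. The indicators of the cells need not converge in norm, so that [weight]
    depends on [mu] as an element of the bidual of [G] that in general does not
    come from [G]. *)
Definition weight (m : nat) : K := ulim W (fun L => mu (ind (cell m L))).

Definition integral_upto (a : nat -> K) (M : nat) : K :=
  \sum_(m < M) a m * weight m.

Definition integral (a : nat -> K) : K := ulim V (integral_upto a).

Lemma weight_bdd m : bdd (fun L => mu (ind (cell m L))).
Proof.
exists (rnorm mu) => L; apply: le_trans (dual_le _ (lexx _)) _.
rewrite ler_piMr ?rnorm_ge0//; apply: linf_norm_le => // s.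
by rewrite indE; case: ifP; rewrite ?rnorm1 ?rnorm0.
Qed.

Lemma integral_upto_cvg a M :
  (fun L => mu (step a M L)) @ W --> integral_upto a M.
Proof.
apply: (@ulim_sum _ _ _ W UW _ M a (fun m L => mu (ind (cell m L)))).
  exact: weight_bdd.
by move=> L; rewrite linear_sum; apply: eq_bigr => m _; rewrite linearZ.
Qed.

Lemma integral_upto_le a (c : R) M : 0 <= c -> (forall m, rnorm (a m) <= c) ->
  rnorm (integral_upto a M) <= c * rnorm mu.
Proof.
move=> c0 ac; apply: (lim_rnorm_le _ (@integral_upto_cvg a M)).
apply: filterE => L; apply: le_trans (dual_le _ (lexx _)) _.
rewrite mulrC ler_wpM2r ?rnorm_ge0//.
by apply: linf_norm_le => // s; exact: step_le.
Qed.

Lemma integral_upto_bdd a (c : R) : 0 <= c -> (forall m, rnorm (a m) <= c) ->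
  bdd (integral_upto a).
Proof. by move=> c0 ac; exists (c * rnorm mu) => M; exact: integral_upto_le. Qed.

Lemma integral_le a (c : R) : 0 <= c -> (forall m, rnorm (a m) <= c) ->
  rnorm (integral a) <= c * rnorm mu.
Proof.
move=> c0 ac; apply: ulim_le; first exact: integral_upto_bdd ac.
by apply: filterE => M; exact: integral_upto_le.
Qed.

Lemma integral_unit m : integral (fun m' => (m' == m)%:R) = weight m.
Proof.
apply: ulim_near; apply: filterS (Vinf m.+1) => M mM.
rewrite /integral_upto (bigD1 (Ordinal mM))//= eqxx mul1r big1 ?addr0// => i.
by rewrite -val_eqE /= => /negbTE ->; rewrite mul0r.
Qed.

End Mu.

Hypothesis ydense :
  forall f : dual X, rnorm f <= 1 -> exists m, rnorm (f - y m) < eps.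

Lemma patch_mono m L L' : {subset L <= L'} -> patch m L' `<=` patch m L.
Proof. by move=> LL' s sL' x /LL'; exact: sL'. Qed.

(** Weak-star compactness of the dual unit ball. Points that escape all the
    patches have an ultrafilter limit in the ball; this limit is within [eps] of
    some [y m] in norm, hence the points themselves enter its patch. *)
Lemma patch_cover (Ls : nat -> seq X) :
  exists M, forall s, exists m, (m < M)%N /\ patch m (Ls m) s.
Proof.
apply: contrapT => /forallNP ncov.
have /choice[s sM] M : exists s, forall m, (m < M)%N -> ~ patch m (Ls m) s.
  have /existsNP[s sM] := ncov M.
  by exists s => m mM pm; apply: sM; exists m.
have sle M x : rnorm (sval (s M) x) <= rnorm x.
  by rewrite -[leRHS]mul1r; apply: dual_le; exact: (svalP (s M)).
pose f x := ulim V (fun M => sval (s M) x).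
have fb x : bdd (fun M => sval (s M) x) by exists (rnorm x) => M.
have fl : linear f.
  move=> a x z; rewrite /f -[a *: ulim _ _]/(a * ulim _ _) -ulim_linear//.
  by congr ulim; apply/funext => M; rewrite linearP.
have f1 x : rnorm (f x) <= 1 * rnorm x.
  by rewrite mul1r; apply: ulim_le => //; exact: filterE.
have [g gf] := bounded_dual fl f1.
have g1 : rnorm g <= 1 by apply: dual_norm_le => // x; rewrite gf.
have [m gm] := ydense g1.
have nr x : x \in Ls m ->
    \forall M \near V, rnorm ((sval (s M) - y m) x) <= eps * rnorm x.
  move=> _; have [->|x0] := eqVneq x 0.
    by apply: filterE => M; rewrite linear0 !rnorm0 mulr0.
  have lt : rnorm (g x - y m x) < eps * rnorm x.
    apply: (le_lt_trans (dual_le x (lexx (rnorm (g - y m))))).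
    by rewrite ltr_pM2r// rnorm_gt0.
  have d0 : 0 < eps * rnorm x - rnorm (g x - y m x) by rewrite subr_gt0.
  have := ulim_cvg UV (fb x); rewrite -/(f x) -gf => /cvgrPdist_le.
  move=> /(_ (of_real k (eps * rnorm x - rnorm (g x - y m x)))).
  rewrite -(@of_real0 R k) of_real_lt => /(_ d0); apply: filterS => M.
  rewrite -rnorm_le => h.
  rewrite -[(sval (s M) - y m) x]/(sval (s M) x - y m x).
  have -> : sval (s M) x - y m x = (g x - y m x) - (g x - sval (s M) x).
    by rewrite opprB [RHS]addrC addrA subrK.
  by apply: le_trans (rnormB _ _) _; rewrite -lerBrDl.
have [M [mM]] := filter_ex (filterI (Vinf m.+1) (near_all UV nr)).
by move=> h; apply: (sM M m mM).
Qed.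

(** Countable additivity on the patches. Choose for each [m] a list [Ls m] at
    which the variation on the patch is almost its infimum over all lists; by
    compactness finitely many of these patches cover the ball, and passing to a
    longer list loses almost nothing on each of them. *)
Lemma variation_patches (mu : dual G) (eta : R) : 0 < eta ->
  exists (M0 : nat) (L0 : seq X), forall (M : nat) (L : seq X),
    (M0 <= M)%N -> {subset L0 <= L} ->
    variation mu (~` [set s | exists m, (m < M)%N /\ patch m L s]) <= eta.
Proof.
move=> eta0.
have inf_patch m : has_inf [set variation mu (patch m L) | L in setT].
  split; first by exists (variation mu (patch m [::])), [::].
  by exists 0 => _ [L _ <-]; exact: variation_ge0.
have d0 m : 0 < eta / 2 ^+ m.+1 by rewrite divr_gt0// exprn_gt0.
have /choice[Ls LsP] m : exists L' : seq X, forall L : seq X, {subset L' <= L} ->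
    variation mu (patch m L' `\` patch m L) <= eta / 2 ^+ m.+1.
  have [_ [L' _ <-] lt] := inf_adherent (d0 m) (inf_patch m).
  exists L' => L LL'.
  have sub := @variation_superadd _ _ _ mu (patch m L' `\` patch m L) (patch m L).
  rewrite setDKI in sub; have {sub} := sub erefl.
  rewrite setUC setDUK; last exact: patch_mono.
  move=> sub; rewrite -(lerD2r (variation mu (patch m L))).
  apply: le_trans sub _; apply: le_trans (ltW lt) _; rewrite addrC lerD2l.
  by apply: ge_inf; [exact: (inf_patch m).2|exists L].
have [M0 cov] := patch_cover Ls.
exists M0, (flatten [seq Ls m | m <- iota 0 M0]) => M L M0M LL.
have LsL m : (m < M0)%N -> {subset Ls m <= L}.
  move=> mM x xL; apply: LL; apply/flattenP; exists (Ls m) => //.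
  by apply/mapP; exists m; rewrite // mem_iota.
apply: (@le_trans _ _ (eta - eta / 2 ^+ M0)); last first.
  by rewrite gerBl divr_ge0 ?ltW// exprn_gt0.
have main N : (N <= M0)%N -> variation mu
    [set s | exists m, (m < N)%N /\ (patch m (Ls m) `\` patch m L) s] <=
    eta - eta / 2 ^+ N.
  elim: N => [_|N IHN NM].
    rewrite expr0 divr1 subrr; apply: variation_le => g g0.
    suff -> : g = 0 by rewrite linear0 rnorm0.
    apply: linf_ext => s; apply: rnorm0_eq0; apply/eqP.
    rewrite eq_le rnorm_ge0 andbT; apply: le_trans (g0 s) _.
    by rewrite memNset// => -[m []].
  apply: le_trans (_ : _ <= variation mu ([set s | exists m, (m < N)%N /\
      (patch m (Ls m) `\` patch m L) s] `|` (patch N (Ls N) `\` patch N L))) _.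
    apply: variation_mono => s [m [+ ms]].
    rewrite ltnS leq_eqVlt => /predU1P[mN|mN]; first by right; rewrite -mN.
    by left; exists m.
  apply: le_trans (variation_subadd _ _ _) _.
  apply: le_trans (lerD (IHN (ltnW NM)) (LsP N L (LsL N NM))) _.
  have -> : eta / 2 ^+ N = eta / 2 ^+ N.+1 + eta / 2 ^+ N.+1.
    by rewrite exprS invfM (mulrC 2^-1) mulrA -splitr.
  by rewrite opprD addrA subrK.
apply: le_trans (main M0 (leqnn _)); apply: variation_mono => s sM.
have [m [mM sm]] := cov s; exists m; split=> //; split=> // sm'.
by apply: sM; exists m; split=> //; exact: leq_trans mM M0M.
Qed.

(** On the [m]-th cell the evaluation at [x] differs by at most
    [eps * rnorm x] from the constant [y m x], and the part of the ball that the
    first [M] cells miss has small variation. *)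
Lemma integral_evaluation (e : X -> G) (mu : dual G) x :
  (forall s, e x s = sval s x) -> rnorm (e x) <= rnorm x ->
  rnorm (mu (e x) - integral mu (fun m => y m x)) <= eps * rnorm x * rnorm mu.
Proof.
move=> eE ex; pose a m := y m x.
have a2 m : rnorm (a m) <= 2 * rnorm x by exact: dual_le.
apply/ler_addgt0Pr => eta eta0.
have x1 : 0 < rnorm x + 1 by rewrite ltr_wpDl// rnorm_ge0.
have [M0 [L0 small]] := variation_patches mu (divr_gt0 eta0 x1).
have bddI := integral_upto_bdd mu (mulr_ge0 (ler0n R 2) (rnorm_ge0 x)) a2.
rewrite /integral; apply: (ulim_sub_le UV bddI).
apply: filterS (Vinf M0) => M M0M.
apply: (rnorm_cvg_le _ (@integral_upto_cvg mu a M)).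
have := near_all UW (fun z (_ : z \in x :: L0) => Winf z).
apply: filterS => L LL.
have xL : x \in L by apply: LL; rewrite mem_head.
have {}small := small M L M0M (fun z zL => LL z (mem_behead (s := x :: L0) zL)).
set U := [set s | _] in small.
pose g := e x - step a M L.
rewrite -[mu (e x) - _]/(mu (e x) - mu (step a M L)) -linearB -/g.
have -> : g = restr U g + restr (~` U) g.
  apply: linf_ext => s; rewrite linf_addE !restrE in_setC.
  by case: (s \in U); rewrite ?addr0 ?add0r.
rewrite linearD; apply: le_trans (rnormD _ _) _; apply: lerD.
  apply: le_trans (dual_le _ (lexx _)) _.
  rewrite mulrC ler_wpM2r ?rnorm_ge0//.
  apply: linf_norm_le => [|s]; first by rewrite mulr_ge0 ?rnorm_ge0.
  rewrite restrE; case: ifPn => [/set_mem[m [mM sm]]|_]; last first.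
    by rewrite rnorm0 mulr_ge0 ?rnorm_ge0.
  rewrite linf_subE eE.
  have [[m' [_ sm' ->]]|[/(_ m mM)//]] := stepE a M L s.
  exact: sm'.
have := @variation_scale _ _ _ mu (~` U) (restr (~` U) g) _ (rnorm_ge0 x).
move=> /(_ _)/le_trans; apply.
  move=> s; rewrite restrE in_setC; case: ifPn => sU; last by rewrite rnorm0 mulr0.
  rewrite mulr1 linf_subE.
  have [[m [mM sm _]]|[_ ->]] := stepE a M L s.
    by case/negP: sU; apply/mem_set; exists m.
  by rewrite subr0; apply: le_trans (linf_le _ s) _.
apply: le_trans (ler_wpM2l (rnorm_ge0 x) small) _.
by rewrite mulrCA ler_piMr ?(ltW eta0)// ler_pdivrMr// mul1r lerDl.
Qed.

Lemma integral_linear_mu a (c : R) : 0 <= c -> (forall m, rnorm (a m) <= c) ->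
  linear (fun mu => integral mu a).
Proof.
move=> c0 ac b mu mu'.
have weight_linear m : weight (b *: mu + mu') m = b * weight mu m + weight mu' m.
  by rewrite /weight -ulim_linear//; [exact: weight_bdd|exact: weight_bdd].
rewrite -[b *: integral _ _]/(b * integral mu a) /integral -ulim_linear//;
  [|exact: integral_upto_bdd ac|exact: integral_upto_bdd ac].
congr ulim; apply/funext => M; rewrite /integral_upto mulr_sumr -big_split.
by apply: eq_bigr => m _; rewrite weight_linear mulrDr mulrCA.
Qed.

Lemma integral_linear_coef mu (b : K) a a' (c : R) : 0 <= c ->
  (forall m, rnorm (a m) <= c) -> (forall m, rnorm (a' m) <= c) ->
  integral mu (fun m => b * a m + a' m) = b * integral mu a + integral mu a'.
Proof.
move=> c0 ac ac'; rewrite /integral -ulim_linear//;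
  [|exact: integral_upto_bdd ac|exact: integral_upto_bdd ac'].
congr ulim; apply/funext => M; rewrite /integral_upto mulr_sumr -big_split.
by apply: eq_bigr => m _; rewrite mulrDl mulrA.
Qed.

End Cells.

(** * Factorization of the bidual inclusion through c0 *)

Section Factorization.
Variables (R : realType) (k : scalar_kind).
Local Notation K := (scalar_field R k).

Lemma dense_approx (V : normedModType K) (D : set V) (v : V) (e : R) :
  dense D -> 0 < e -> exists2 d, D d & rnorm (v - d) < e.
Proof.
move=> Dd e0.
have e0' : 0 < of_real k e by rewrite -(@of_real0 R k) of_real_lt.
have [] := Dd (interior (ball v (of_real k e))); last 1 first.
- move=> d [/interior_subset + Dd']; rewrite -ball_normE /= => vd.
  by exists d => //; rewrite -(@of_real_lt R k) rnormE.
- exists v; exact: nbhsx_ballx.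
- exact: open_interior.
Qed.

Lemma countable_enum (T : Type) (t0 : T) (D : set T) :
  countable D -> exists u : nat -> T, forall d, D d -> exists m, u m = d.
Proof.
move=> /pfcard_geP[->|[f]]; first by exists (fun=> t0).
by exists f => d /(@surj _ _ _ _ f)[m _ <-]; exists m.
Qed.

Lemma ultra_nat : exists V : set_system nat, UltraFilter V /\
  forall M0, \forall M \near V, (M0 <= M)%N.
Proof.
have [V [UV sV]] := @ultraFilterLemma nat (\oo) _.
exists V; split=> // M0; apply: sV; exact: nbhs_infty_ge.
Qed.

Lemma ultra_seq (T : eqType) : exists W : set_system (seq T), UltraFilter W /\
  forall x, \forall L \near W, x \in L.
Proof.
pose B (L0 : seq T) : set (seq T) := [set L : seq T | {subset L0 <= L}].
have BF : ProperFilter (filter_from [set: seq T] B).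
  apply: filter_from_proper; last by move=> L _; exists L.
  apply: filter_from_filter; first by exists [::].
  move=> L1 L2 _ _; exists (L1 ++ L2) => // L LL.
  by split=> x xL; apply: LL; rewrite mem_cat xL ?orbT.
have [W [UW sW]] := ultraFilterLemma BF.
exists W; split=> // x; apply: sW; exists [:: x] => // L; apply.
exact: mem_head.
Qed.

Definition c0_unit_fun (m : nat) : nat -> K := fun m' => (m' == m)%:R.

Lemma c0_unit_subproof m : c0_unit_fun m \in @c0_pred R k nat.
Proof.
rewrite inE => e e0.
apply: (sub_finite_set (B := [set m])); last exact: finite_set1.
move=> m' /=; rewrite /c0_unit_fun; case: eqP => // _.
by rewrite rnorm0 leNgt e0.
Qed.

Definition c0_unit (m : nat) : c0 R k nat := C0 (c0_unit_subproof m).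

Lemma c0_sumE (I : Type) (r : seq I) (g : I -> c0 R k nat) s :
  (\sum_(i <- r) g i) s = \sum_(i <- r) g i s.
Proof. by elim/big_rec2: _ => [|i x y _ <-]. Qed.

Lemma c0_le (a : c0 R k nat) m : rnorm (a m) <= rnorm a.
Proof. by rewrite c0_normE; apply: sup_norm_ub => //; exact: c0_bounded. Qed.

(** The partial sums are values of [phi] at finitely supported sequences
    bounded by [c]. *)
Lemma c0_functional_upto (phi : dual (c0 R k nat)) (a : nat -> K) (c : R) M :
  0 <= c -> (forall m, rnorm (a m) <= c) ->
  rnorm (\sum_(m < M) a m * phi (c0_unit m)) <= c * rnorm phi.
Proof.
move=> c0 ac.
have -> : \sum_(m < M) a m * phi (c0_unit m) = phi (\sum_(m < M) a m *: c0_unit m).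
  by rewrite linear_sum; apply: eq_bigr => m _; rewrite linearZ.
apply: le_trans (dual_le _ (lexx _)) _; rewrite mulrC ler_wpM2r ?rnorm_ge0//.
rewrite c0_normE; apply: sup_norm_le => // m _; rewrite c0_sumE.
have aE (i : 'I_M) : (a i *: c0_unit i) m = a i * (m == i)%:R by [].
under eq_bigr do rewrite aE.
have [mM|Mm] := ltnP m M.
  rewrite (bigD1 (Ordinal mM))//= eqxx mulr1 big1 ?addr0// => i.
  by rewrite -val_eqE /= eq_sym => /negbTE ->; rewrite mulr0.
rewrite big1 ?rnorm0// => i _; case: eqP => [mi|]; last by rewrite mulr0.
by move: Mm; rewrite mi leqNgt ltn_ord.
Qed.

(** The data of an approximate factorization of the inclusion of [X] in the
    bidual of a superspace through the bidual of [c0]. The map [fac_c0] lives on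
    [c0] and takes values in the bidual; [fac_bidual] followed by the weak-star
    continuous extension of [fac_c0] is the factorization, and [fac_rest] is its
    defect, as [factors_up_to] makes precise. *)
Record c0_factor (X : completeNormedModType K) := C0Factor {
  fac_space : completeNormedModType K;
  fac_in : {linear X -> fac_space};
  fac_c0 : {linear c0 R k nat -> dual (dual fac_space)};
  fac_bidual : {linear X -> dual (dual (c0 R k nat))};
  fac_rest : {linear X -> dual (dual fac_space)};
  fac_in_norm : forall x, rnorm (fac_in x) = rnorm x;
  fac_c0_le : forall a, rnorm (fac_c0 a) <= rnorm a;
  fac_bidual_le : forall x, rnorm (fac_bidual x) <= 2 * rnorm x
}.

Definition factors_up_to (X : completeNormedModType K) (f : c0_factor X)
    (eps : R) : Prop :=
  (forall x, rnorm (fac_rest f x) <= eps * rnorm x) /\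
  forall x mu (phi : dual (c0 R k nat)), (forall a, phi a = fac_c0 f a mu) ->
    fac_rest f x mu = mu (fac_in f x) - fac_bidual f x phi.

(** A default for the coordinates that are left alone. *)
Lemma trivial_factor (X : completeNormedModType K) : c0_factor X.
Proof.
apply: (@C0Factor X X idfun (GRing.null_fun _) (GRing.null_fun _)
  (GRing.null_fun _)) => //.
  by move=> a; rewrite rnorm0 rnorm_ge0.
by move=> x; rewrite rnorm0 mulr_ge0 ?rnorm_ge0.
Qed.

(** The dual unit ball is cut into countably many cells of norm radius [eps]; a
    functional on the bounded functions is replaced by its weights on the cells,
    and each cell by the centre of its norm ball. As the cells are disjoint, the
    weights of [mu] are summable against bounded sequences, in particular against
    those in [c0]. *)
Theorem c0_factor_exists (X : completeNormedModType K) (eps : R) :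
  separable (dual X) -> 0 < eps -> exists f : c0_factor X, factors_up_to f eps.
Proof.
move=> [D [cD dD]] eps0.
have [u uD] := countable_enum 0 cD.
pose y m := if rnorm (u m) <= 2 then u m else 0.
have y2 m : rnorm (y m) <= 2.
  by rewrite /y; case: ifP => //; rewrite rnorm0.
have ydense (f : dual X) : rnorm f <= 1 -> exists m, rnorm (f - y m) < eps.
  move=> f1; have e0 : 0 < Num.min eps 1 by rewrite lt_min eps0 ltr01.
  have [d /uD[m dm]] := dense_approx f dD e0.
  rewrite lt_min => /andP[lte lt1]; exists m; rewrite /y dm.
  (* The elements of norm at most 2 suffice to approximate the unit ball. *)
  rewrite ifT// -[d](subKr f); apply: le_trans (rnormB _ _) _.
  by rewrite -[2]/(1 + 1); apply: lerD => //; exact: ltW.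
have [V [UV Vinf]] := ultra_nat.
have [W [UW Winf]] := ultra_seq X.
have [e [eE en]] := evaluation_exists X.
pose G := linf R k (dual_ball X).
pose I (mu : dual G) a := integral y eps V W mu a.
have c0B (a : c0 R k nat) m : rnorm (a m) <= rnorm a := c0_le a m.
have yB x m : rnorm (y m x) <= 2 * rnorm x by exact: dual_le.
have y0 (x : X) : 0 <= 2 * rnorm x by rewrite mulr_ge0 ?rnorm_ge0.
have [P [PE PN]] : exists P : {linear c0 R k nat -> dual (dual G)},
    (forall a mu, P a mu = I mu a) /\ forall a, rnorm (P a) <= 1 * rnorm a.
  apply: bidual_map => // [a|mu|a mu].
  - by exact: (integral_linear_mu y eps UV UW (rnorm_ge0 a) (c0B a)).
  - move=> b a a'.
    apply: (@integral_linear_coef _ _ _ y eps V W UV UW mu b a a'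
      (Num.max (rnorm a) (rnorm a'))).
    + by rewrite le_max rnorm_ge0.
    + by move=> m; rewrite le_max c0B.
    + by move=> m; rewrite le_max c0B orbT.
  - by rewrite mul1r; exact: (integral_le y eps UV UW mu (rnorm_ge0 a) (c0B a)).
have [B [BE BN]] : exists B : {linear X -> dual (dual (c0 R k nat))},
    (forall x phi, B x phi =
      ulim V (fun M => \sum_(m < M) y m x * phi (c0_unit m))) /\
    forall x, rnorm (B x) <= 2 * rnorm x.
  have bB x (phi : dual (c0 R k nat)) :
      bdd (fun M => \sum_(m < M) y m x * phi (c0_unit m)).
    exists (2 * rnorm x * rnorm phi) => M.
    exact: (c0_functional_upto phi M (y0 x) (yB x)).
  apply: bidual_map => // [x|phi|x phi].
  - move=> b phi psi; rewrite -[b *: ulim _ _]/(b * ulim _ _) -ulim_linear//.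
    congr ulim; apply/funext => M; rewrite mulr_sumr -big_split.
    by apply: eq_bigr => m _; rewrite /= mulrDr mulrCA.
  - move=> b x x'; rewrite -[b *: ulim _ _]/(b * ulim _ _) -ulim_linear//.
    congr ulim; apply/funext => M; rewrite mulr_sumr -big_split.
    by apply: eq_bigr => m _; rewrite linearP mulrDl mulrA.
  - apply: ulim_le => //; apply: filterE => M.
    exact: (c0_functional_upto phi M (y0 x) (yB x)).
pose L x (mu : dual G) := mu (e x) - I mu (fun m => y m x).
have [Q [QE QN]] : exists Q : {linear X -> dual (dual G)},
    (forall x mu, Q x mu = L x mu) /\ forall x, rnorm (Q x) <= eps * rnorm x.
  apply: bidual_map => [|x|mu|x mu].
  - exact: ltW.
  - move=> b mu mu'; rewrite /L.
    rewrite /I (integral_linear_mu y eps UV UW (y0 x) (yB x)).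
    rewrite -[b *: (_ - _)]/(b * _) mulrBr opprD addrACA.
    by [].
  - move=> b x x'; rewrite /L linearP.
    have -> : (fun m => y m (b *: x + x')) = (fun m => b * y m x + y m x').
      by apply/funext => m; rewrite linearP.
    rewrite /I (@integral_linear_coef _ _ _ y eps V W UV UW mu b _ _
      (Num.max (2 * rnorm x) (2 * rnorm x'))).
    + by rewrite linearP -[b *: (_ - _)]/(b * _) mulrBr opprD addrACA.
    + by rewrite le_max y0.
    + by move=> m; rewrite le_max yB.
    + by move=> m; rewrite le_max yB orbT.
  - apply: integral_evaluation => //; first exact: ltW.
    by rewrite en.
have P1 a : rnorm (P a) <= rnorm a by have := PN a; rewrite mul1r.
exists (@C0Factor X (linf R k (dual_ball X)) e P B Q en P1 BN).
split=> //= x mu phi phiE.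
rewrite QE /L BE; congr (_ - _); rewrite /I /integral; congr ulim.
apply/funext => M; apply: eq_bigr => m _.
by rewrite phiE PE /I -(integral_unit y eps W UV Vinf).
Qed.

End Factorization.

(** * Operators of finite type and lifts to biduals *)

Section FiniteType.
Variables (R : realType) (k : scalar_kind) (n : nat).
Local Notation K := (scalar_field R k).
Local Notation Banach := (completeNormedModType K).
Variables (A : ideal R k n) (F : Banach).

Definition elem_op (X : 'I_n -> Banach) (phi : forall i, dual (X i)) (f : F) :
    (forall i, X i) -> F :=
  fun x => (\prod_i phi i (x i)) *: f.

Definition finite_type (X : 'I_n -> Banach) (S : (forall i, X i) -> F) : Prop :=
  exists s : seq ((forall i, dual (X i)) * F),
    S = \sum_(p <- s) elem_op p.1 p.2.

Definition approximable (X : 'I_n -> Banach) : Prop :=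
  forall T, A X F T -> forall e : R, 0 < e ->
  exists S, finite_type S /\ ideal_norm A X F (T - S) < e.

(** Compose the multiplication of scalars with the functionals in its arguments
    and with the multiples of [f] at its value. *)
Lemma elem_op_mem (X : 'I_n -> Banach) (phi : forall i, dual (X i)) (f : F) :
  A X F (elem_op phi f) /\
  ideal_norm A X F (elem_op phi f) <= rnorm f * \prod_i rnorm (phi i).
Proof.
have /(_ _)/cid lin i : exists P : {linear X i -> scalar_banach R k}, P =1 phi i.
  have [P PE] := @linear_map R k (X i) (scalar_banach R k) (phi i)
    (dual_linear (phi i)).
  by exists P.
pose P i := sval (lin i); have PE i : P i =1 phi i := svalP (lin i).
have Slin : linear (fun a : scalar_banach R k => (a : K) *: f).
  by move=> a u v; rewrite scalerDl scalerA.
have [S SE] := linear_map Slin.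
have Pn i x : rnorm (P i x) <= rnorm (phi i) * rnorm x.
  by rewrite PE; exact: dual_le.
have Sn a : rnorm (S a) <= rnorm f * rnorm a by rewrite SE rnormZ mulrC.
have [mem1 norm1] := ideal_prod A.
have [] := @ideal_comp _ _ _ A X (fun=> scalar_banach R k)
  (scalar_banach R k) F P S _ _ _ mem1.
- by move=> i; exact: lin_bounded_cont (Pn i).
- exact: lin_bounded_cont Sn.
have -> : (fun x : forall i, X i => S (\prod_i (P i (x i) : K))) = elem_op phi f.
  apply/funext => x; rewrite SE; congr (_ *: _).
  by apply: eq_bigr => i _; rewrite PE.
move=> Ax le; split=> //; apply: le_trans le _.
rewrite norm1 mulr1; apply: ler_pM.
- exact: sup_norm_ge0.
- by apply: prodr_ge0 => i _; exact: sup_norm_ge0.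
- by apply: op_norm_le => //; exact: rnorm_ge0.
- apply: ler_prod => i _; rewrite sup_norm_ge0/=.
  by apply: op_norm_le => //; exact: rnorm_ge0.
Qed.

Lemma ideal_memD (X : 'I_n -> Banach) S T :
  A X F S -> A X F T -> A X F (S + T).
Proof.
by move=> AS AT; have := (ideal_subspace A X F).2 1 S T AS AT; rewrite scale1r.
Qed.

Lemma ideal_memB (X : 'I_n -> Banach) S T :
  A X F S -> A X F T -> A X F (S - T).
Proof.
move=> AS AT; have := (ideal_subspace A X F).2 (-1) T S AT AS.
by rewrite scaleN1r addrC.
Qed.

Lemma finite_type_mem (X : 'I_n -> Banach) (S : (forall i, X i) -> F) :
  finite_type S -> A X F S.
Proof.
move=> [s ->]; elim: s => [|p s IHs].
  by rewrite big_nil; exact: (ideal_subspace A X F).1.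
by rewrite big_cons; apply: ideal_memD => //; exact: (elem_op_mem _ _).1.
Qed.

End FiniteType.

Section Lift.
Variables (R : realType) (k : scalar_kind) (n : nat) (j : 'I_n).
Local Notation K := (scalar_field R k).
Local Notation Banach := (completeNormedModType K).
Variables (Z Y : 'I_n -> Banach).
Variables (f : forall i, {linear Z i -> dual (dual (Y i))}).
Variables (g : forall i, {linear Z i -> Y i}).

(** Giving [f] at every index, and not only at [j], puts the case distinction
    inside the type, where it replaces a transport along [i = j]. *)
Definition lift_map (i : 'I_n) : {linear Z i -> arens_fam j Y i} :=
  if i == j as b
    return {linear Z i -> (if b then (dual (dual (Y i)) : Banach) else Y i)}
  then f i else g i.

Lemma arens_bidual_lift (c : forall i, Z i) :
  arens_bidual (fun i => lift_map i (c i)) j = f j (c j).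
Proof.
suff gen i : i == j ->
    arens_bidual (fun i => lift_map i (c i)) i = f i (c i).
  by apply: gen.
by rewrite /arens_bidual /lift_map /arens_fam; case: (i == j).
Qed.

Lemma arens_base_lift (c : forall i, Z i) :
  arens_base (fun i => lift_map i (c i)) =
  (fun i => if i == j then 0 else g i (c i)).
Proof.
apply: functional_extensionality_dep => i.
by rewrite /arens_base /lift_map /arens_fam; case: (i == j).
Qed.

Lemma lift_map_le (C D : R) : (forall x, rnorm (f j x) <= C * rnorm x) ->
  (forall i x, rnorm (g i x) <= D * rnorm x) ->
  forall i x, rnorm (lift_map i x) <= (if i == j then C else D) * rnorm x.
Proof.
move=> fC gD i x.
have : i == j -> rnorm (f i x) <= C * rnorm x by move/eqP => ij; subst i.
rewrite /lift_map /arens_fam; case: (i == j) => [|_]; first exact.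
exact: gD.
Qed.

Lemma lift_map_prod (C D : R) : 0 <= C -> 0 <= D <= 1 ->
  (forall x, rnorm (f j x) <= C * rnorm x) ->
  (forall i x, rnorm (g i x) <= D * rnorm x) ->
  (forall i, continuous (lift_map i)) /\ \prod_i op_norm (lift_map i) <= C.
Proof.
move=> C0 /andP[D0 D1] fC gD; have le := lift_map_le fC gD.
split=> [i|]; first exact: lin_bounded_cont (le i).
have ole i : 0 <= op_norm (lift_map i) <= (if i == j then C else D).
  by rewrite sup_norm_ge0 op_norm_le//; case: ifP.
apply: (@le_trans _ _ (\prod_i (if i == j then C else D))).
  by apply: ler_prod => i _; exact: ole.
rewrite (bigD1 j)//= eqxx ler_piMr// prodr_ile1// => i /negbTE ->.
by rewrite D0.
Qed.

Variable F : Banach.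

Definition slice (T : (forall i, Y i) -> F) (cT : continuous_multilinear T)
    (y : forall i, Y i) (y' : dual F) : dual (Y j) :=
  Dual (@arens_slice_dual R k n j Y F T y y' cT).

Lemma arens_ext_lift (T : (forall i, Y i) -> F) (cT : continuous_multilinear T)
    (c : forall i, Z i) (y' : dual F) :
  arens_ext T (fun i => lift_map i (c i)) y' =
  f j (c j) (slice cT (fun i => if i == j then 0 else g i (c i)) y').
Proof.
rewrite /arens_ext arens_bidual_lift arens_base_lift; congr (f j (c j) _).
by apply/val_inj; rewrite insubdK //; exact: arens_slice_dual.
Qed.

End Lift.

(** * Replacing one variable by c0 *)

(** One variable, the [j]-th, is passed through [c0]. The families are kept
    abstract, so that no coordinate has to be transported along an equality of
    types: off [j] the maps [a], [r] and [b] are inclusions or identities, while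
    at [j] the space [W j] is the superspace of [X j] and [Y j] is [c0]. *)
Section OneStep.
Variables (R : realType) (k : scalar_kind) (n : nat).
Local Notation K := (scalar_field R k).
Local Notation Banach := (completeNormedModType K).
Variables (A : ideal R k n) (F : Banach).

Lemma ideal_norm_ge0 (X : 'I_n -> Banach) T : A X F T -> 0 <= ideal_norm A X F T.
Proof.
move=> AT; have [ND NZ _] := ideal_norm_on A X F.
have A0 := (ideal_subspace A X F).1.
have ANT : A X F (- T) by rewrite -sub0r; exact: ideal_memB.
have := ND _ _ AT ANT; rewrite subrr -scaleN1r NZ// rnormN rnorm1 mul1r.
by rewrite -[0 in X in X -> _](scale0r 0) NZ// rnorm0 mul0r -mulr2n pmulrn_lge0.
Qed.

Lemma ideal_comp_le (X Y : 'I_n -> Banach) (L : forall i, {linear X i -> Y i})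
    (U : (forall i, Y i) -> F) (C : R) :
  A Y F U -> (forall i, continuous (L i)) -> \prod_i op_norm (L i) <= C ->
  A X F (fun x => U (fun i => L i (x i))) /\
  ideal_norm A X F (fun x => U (fun i => L i (x i))) <= ideal_norm A Y F U * C.
Proof.
move=> AU cL LC.
have [] := @ideal_comp _ _ _ A X Y F F L idfun U cL _ AU.
  by move=> x; exact: cvg_id.
move=> AUL le; split=> //; apply: le_trans le _.
have U0 := ideal_norm_ge0 AU.
apply: ler_pM => //.
- by rewrite mulr_ge0 ?sup_norm_ge0.
- by apply: prodr_ge0 => i _; exact: sup_norm_ge0.
- rewrite ler_piMl//; apply: op_norm_le => // x.
  by rewrite mul1r.
Qed.

Lemma dual_sumE (E : Banach) (I : Type) (s : seq I) (g : I -> dual E) x :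
  (\sum_(i <- s) g i) x = \sum_(i <- s) g i x.
Proof. by elim/big_rec2: _ => [|i u v _ <-]. Qed.

Variables (j : 'I_n) (X W Y : 'I_n -> Banach).
Variables (a : forall i, {linear X i -> W i}) (r : forall i, {linear Y i -> W i}).
Variable b : forall i, {linear X i -> Y i}.
Variable P : forall i, {linear Y i -> dual (dual (W i))}.
Variable B : forall i, {linear X i -> dual (dual (Y i))}.
Variable d : forall i, {linear X i -> dual (dual (W i))}.
Variable eps : R.
Hypothesis eps0 : 0 <= eps.
Hypothesis off : forall i, i != j -> forall x, r i (b i x) = a i x.
Hypothesis a1 : forall i x, rnorm (a i x) <= 1 * rnorm x.
Hypothesis r1 : forall i x, rnorm (r i x) <= 1 * rnorm x.
Hypothesis b1 : forall i x, rnorm (b i x) <= 1 * rnorm x.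
Hypothesis P1 : forall x, rnorm (P j x) <= 1 * rnorm x.
Hypothesis B2 : forall i x, rnorm (B i x) <= 2 * rnorm x.
Hypothesis deps : forall x, rnorm (d j x) <= eps * rnorm x.
Hypothesis dE : forall x mu (phi : dual (Y j)),
  (forall c, phi c = P j c mu) -> d j x mu = mu (a j x) - B j x phi.
Hypothesis stab : arens_stable A F.

Lemma pullback_functional (i : 'I_n) (phi : dual (Y i)) :
  exists q : dual (X i),
    forall x, q x = if i == j then B i x phi else phi (b i x).
Proof.
pose f x := if i == j then B i x phi else phi (b i x).
have fl : linear f.
  by move=> c x y; rewrite /f; case: (i == j); rewrite linearP// dual_linear.
have fM x : rnorm (f x) <= 2 * rnorm phi * rnorm x.
  rewrite /f; case: (i == j).
    apply: le_trans (dual_le _ (B2 x)) _.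
    by rewrite mulrAC.
  apply: le_trans (dual_le _ (lexx _)) _.
  rewrite (mulrC 2) -mulrA ler_wpM2l ?rnorm_ge0//.
  apply: le_trans (b1 x) _; rewrite ler_wpM2r ?rnorm_ge0//.
  by rewrite ler1n.
by have [q qE] := bounded_dual fl fM; exists q.
Qed.

(** With [Th] the Arens extension of [Tw], the operator [T0] on the family [Y]
    is [Th] after [P]. If [S] approximates [T0], then the Arens extension [Qh] of
    [T0 - S] composed with [B] differs from the factored form of [T] by a finite
    type operator, whence
    [T - S1 = Th (d, a, ..., a) + Qh (B, b, ..., b)],
    and both terms are small by the ideal property. *)
Lemma one_step (T : (forall i, X i) -> F) (Tw : (forall i, W i) -> F) (eta : R) :
  approximable A F Y -> A X F T -> A W F Tw ->
  (forall x, Tw (fun i => a i (x i)) = T x) -> 0 < eta ->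
  exists S, finite_type S /\
    ideal_norm A X F (T - S) <= ideal_norm A W F Tw * eps + eta.
Proof.
move=> appr AT ATw TwE eta0.
have [Th [ATh ThE Thn]] := stab j ATw.
have cTw := ideal_continuous_multilinear ATw.
have h01 : (0 : R) <= (1 : R) <= (1 : R) by rewrite ler01 lexx.
have [cPr nPr] := lift_map_prod ler01 h01 P1 r1.
have [cda nda] := lift_map_prod eps0 h01 deps a1.
have [cBb nBb] := lift_map_prod (ler0n _ 2) h01 (B2 (i := j)) b1.
pose T0 c := Th (fun i => lift_map j P r i (c i)).
have [AT0 _] := ideal_comp_le ATh cPr nPr; rewrite -/T0 in AT0.
have eta20 : 0 < eta / 2 by rewrite divr_gt0.
have [S [[s SE] nS]] := appr T0 AT0 (eta / 2) eta20.
have fS : finite_type S by exists s.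
have AQ : A Y F (T0 - S) by apply: ideal_memB => //; exact: finite_type_mem fS.
have [Qh [AQh QhE Qhn]] := stab j AQ.
have cT0 := ideal_continuous_multilinear AT0.
have cQ := ideal_continuous_multilinear AQ.
pose pull (phi : forall i, dual (Y i)) i :=
  sval (cid (pullback_functional (phi i))).
have pullE phi i x :
    pull phi i x = if i == j then B i x (phi i) else phi i (b i x).
  exact: (svalP (cid (pullback_functional (phi i)))).
pose S1 := \sum_(p <- s) elem_op (pull p.1) p.2.
have fS1 : finite_type S1.
  by exists [seq (pull p.1, p.2) | p <- s]; rewrite big_map.
have main : T - S1 = (fun x => Th (fun i => lift_map j d a i (x i))) +
    (fun x => Qh (fun i => lift_map j B b i (x i))).
  apply/funext => x; apply: dual_separates => y'.
  rewrite -[LHS]/(y' (T x - S1 x)).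
  rewrite -[RHS]/(y' (Th (fun i => lift_map j d a i (x i)) +
    Qh (fun i => lift_map j B b i (x i)))).
  rewrite linearB linearD /= ThE QhE.
  rewrite (arens_ext_lift j d a cTw) (arens_ext_lift j B b cQ).
  set ya := fun i => if i == j then 0 else a i (x i).
  set yb := fun i => if i == j then 0 else b i (x i).
  pose mu := slice j cTw ya y'.
  rewrite -/mu (dE _ (phi := slice j cT0 yb y')); last first.
    move=> c.
    rewrite -[LHS]/(y' (Th (fun i => lift_map j P r i (dfwith yb j c i)))).
    rewrite ThE (arens_ext_lift j P r cTw) dfwithin; congr (P j c _).
    rewrite /mu; congr slice; apply: functional_extensionality_dep => i.
    rewrite /ya; case: (eqVneq i j) => // ij.
    by rewrite dfwithout 1?eq_sym// /yb (negbTE ij) off.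
  have -> : mu (a j (x j)) = y' (T x).
    rewrite -[LHS]/(y' (Tw (dfwith ya j (a j (x j))))) -TwE; congr (y' (Tw _)).
    apply: functional_extensionality_dep => i.
    case: dfwithP => // i' ij; rewrite /ya ifN// eq_sym.
    by [].
  pose coef (p : (forall i, dual (Y i)) * F) : K :=
    (\prod_(i | i != j) p.1 i (b i (x i))) * y' p.2.
  have -> : slice j cQ yb y' = slice j cT0 yb y' - \sum_(p <- s) coef p *: p.1 j.
    apply/val_inj/funext => c.
    rewrite -[LHS]/(y' (T0 (dfwith yb j c) - S (dfwith yb j c))).
    rewrite linearB /= -[RHS]/(slice j cT0 yb y' c -
      (\sum_(p <- s) coef p *: p.1 j : dual (Y j)) c).
    congr (_ - _); rewrite dual_sumE SE fct_sumE linear_sum.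
    apply: eq_bigr => p _; rewrite linearZ /= -[RHS]/(coef p * p.1 j c) /coef.
    rewrite (bigD1 j)//= dfwithin -[LHS]mulrA [LHS]mulrC.
    congr (_ * _ * _); apply: eq_bigr => i ij.
    by rewrite dfwithout 1?eq_sym// /yb (negbTE ij).
  rewrite linearB /= linear_sum addrA subrK; congr (_ - _).
  rewrite /S1 fct_sumE linear_sum. apply: eq_bigr => p _.
  rewrite !linearZ /= /coef (bigD1 j)//= pullE eqxx -[LHS]mulrA [LHS]mulrC.
  by congr (_ * _ * _); apply: eq_bigr => i ij; rewrite pullE (negbTE ij).
exists S1; split => //; rewrite main.
have [Ad nd] := ideal_comp_le ATh cda nda.
have [AB nB] := ideal_comp_le AQh cBb nBb.
have [ND _ _] := ideal_norm_on A X F.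
apply: le_trans (ND _ _ Ad AB) _; apply: lerD.
  by rewrite -Thn.
apply: le_trans nB _; rewrite Qhn -ler_pdivlMr//; exact: ltW.
Qed.

End OneStep.

Section Step.
Variables (R : realType) (k : scalar_kind) (n : nat).
Local Notation K := (scalar_field R k).
Local Notation Banach := (completeNormedModType K).
Variables (A : ideal R k n) (F : Banach).
Hypothesis stab : arens_stable A F.
Hypothesis ext : extendible A.

Definition c0_nat : Banach := c0 R k nat.

Definition c0_at (j : 'I_n) (X : 'I_n -> Banach) (i : 'I_n) : Banach :=
  if i == j then c0_nat else X i.

(** Extend [T] to the superspace in the [j]-th variable and factor there. *)
Lemma approximable_step (j : 'I_n) (X : 'I_n -> Banach) :
  separable (dual (X j)) ->
  approximable A F (c0_at j X) -> approximable A F X.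
Proof.
move=> sep appr T AT e e0.
set N := ideal_norm A X F T.
have N0 : 0 <= N := ideal_norm_ge0 AT.
have N1 : 0 < N + 1 by rewrite ltr_wpDl.
have e20 : 0 < e / 2 by rewrite divr_gt0.
pose eps := e / 2 / (N + 1).
have eps0 : 0 < eps by rewrite divr_gt0.
have /(_ _)/cid ex i : exists f : c0_factor (X i), i == j -> factors_up_to f eps.
  have [ij|_] := eqVneq i j; last by exists (trivial_factor (X i)).
  by rewrite -ij in sep; have [f fP] := c0_factor_exists sep eps0; exists f.
pose D i : c0_factor (X i) := sval (ex i).
have DP i : i == j -> factors_up_to (D i) eps := svalP (ex i).
(* All families are defined by the same case distinction on [i == j], so that
   each hypothesis below follows by deciding it. *)
pose W i : Banach := if i == j then fac_space (D i) else X i.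
pose a i : {linear X i -> W i} :=
  if i == j as b return {linear X i -> (if b then fac_space (D i) else X i)}
  then fac_in (D i) else idfun.
pose r i : {linear c0_at j X i -> W i} :=
  if i == j as b return {linear (if b then c0_nat else X i) ->
    (if b then fac_space (D i) else X i)}
  then GRing.null_fun _ else idfun.
pose b i : {linear X i -> c0_at j X i} :=
  if i == j as b return {linear X i -> (if b then c0_nat else X i)}
  then GRing.null_fun _ else idfun.
pose P i : {linear c0_at j X i -> dual (dual (W i))} :=
  if i == j as b return {linear (if b then c0_nat else X i) ->
    dual (dual (if b then fac_space (D i) else X i))}
  then fac_c0 (D i) else GRing.null_fun _.
pose B i : {linear X i -> dual (dual (c0_at j X i))} :=
  if i == j as b return {linear X i -> dual (dual (if b then c0_nat else X i))}
  then fac_bidual (D i) else GRing.null_fun _.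
pose d i : {linear X i -> dual (dual (W i))} :=
  if i == j as b return
    {linear X i -> dual (dual (if b then fac_space (D i) else X i))}
  then fac_rest (D i) else GRing.null_fun _.
have an i x : rnorm (a i x) = rnorm x.
  by rewrite /a /W; case: (i == j) => //; exact: fac_in_norm.
have [Tw [ATw TwE TwN]] : exists T', [/\ A W F T',
    forall x, T' (fun j => a j (x j)) = T x &
    ideal_norm A W F T' = ideal_norm A X F T].
  by apply: ext => // i x; rewrite -!rnormE an.
have off i : i != j -> forall x, r i (b i x) = a i x.
  by rewrite /r /b /a /W /c0_at; case: (i == j).
have a1 i x : rnorm (a i x) <= 1 * rnorm x by rewrite an mul1r.
have r1 i x : rnorm (r i x) <= 1 * rnorm x.
  rewrite mul1r /r; move: x; rewrite /W /c0_at; case: (i == j) => x //=.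
  by rewrite rnorm0 rnorm_ge0.
have b1 i x : rnorm (b i x) <= 1 * rnorm x.
  rewrite mul1r /b /c0_at; case: (i == j) => //=.
  by rewrite rnorm0 rnorm_ge0.
have P1 x : rnorm (P j x) <= 1 * rnorm x.
  suff gen i z : rnorm (P i z) <= rnorm z by rewrite mul1r.
  rewrite /P; move: z; rewrite /W /c0_at; case: (i == j) => z /=.
    exact: fac_c0_le.
  by rewrite rnorm0 rnorm_ge0.
have B2 i x : rnorm (B i x) <= 2 * rnorm x.
  rewrite /B /c0_at; case: (i == j) => /=; first exact: fac_bidual_le.
  by rewrite rnorm0 mulr_ge0 ?rnorm_ge0.
have deps x : rnorm (d j x) <= eps * rnorm x.
  suff gen i z : i == j -> rnorm (d i z) <= eps * rnorm z by exact: gen.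
  have := DP i; rewrite /d /W; case: (i == j) => // /(_ isT)[h _] _; exact: h.
have dE x mu (phi : dual (c0_at j X j)) : (forall c, phi c = P j c mu) ->
    d j x mu = mu (a j x) - B j x phi.
  suff gen i z (nu : dual (W i)) (psi : dual (c0_at j X i)) : i == j ->
      (forall c, psi c = P i c nu) -> d i z nu = nu (a i z) - B i z psi.
    by apply: gen.
  have := DP i; move: nu psi; rewrite /d /a /B /P /W /c0_at.
  by case: (i == j) => // nu psi /(_ isT)[_ h] _; exact: h.
have [S [fS le]] := one_step (ltW eps0) off a1 r1 b1 P1 B2 deps dE stab
  appr AT ATw TwE e20.
exists S; split=> //; apply: le_lt_trans le _.
rewrite TwN -/N [ltRHS](splitr e) ltrD2r /eps mulrCA gtr_pMr//.
by rewrite ltr_pdivrMr// mul1r ltrDl.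
Qed.

End Step.

(** * Operators on c0 *)

Section Elementary.
Variables (R : realType) (k : scalar_kind) (n : nat).
Local Notation K := (scalar_field R k).
Local Notation Banach := (completeNormedModType K).
Variables (A : ideal R k n) (F : Banach).

Lemma finite_type0 (X : 'I_n -> Banach) : finite_type (0 : (forall i, X i) -> F).
Proof. by exists [::]; rewrite big_nil. Qed.

Lemma finite_typeD (X : 'I_n -> Banach) (S T : (forall i, X i) -> F) :
  finite_type S -> finite_type T -> finite_type (S + T).
Proof. by move=> [s ->] [t ->]; exists (s ++ t); rewrite big_cat. Qed.

Lemma finite_typeZ (X : 'I_n -> Banach) (c : K) (S : (forall i, X i) -> F) :
  finite_type S -> finite_type (c *: S).
Proof.
move=> [s ->]; exists [seq (p.1, c *: p.2) | p <- s].
rewrite big_map scaler_sumr; apply: eq_bigr => p _.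
apply/funext => x; rewrite -[LHS]/(c *: (_ *: _)) /elem_op /=.
by rewrite !scalerA mulrC.
Qed.

(** The factors [p i] are multiples of slices of [t] through a point where [t]
    does not vanish, so they inherit linearity and continuity from [t]. *)
Lemma finite_type_prod (X : 'I_n -> Banach) (p : forall i, X i -> K) (f : F)
    (t : (forall i, X i) -> F) :
  continuous_multilinear t -> (forall x, t x = (\prod_i p i (x i)) *: f) ->
  finite_type t.
Proof.
move=> ct tE.
have [[y0 ty0]|t0] := pselect (exists y, t y != 0); last first.
  rewrite (_ : t = 0); first exact: finite_type0.
  apply/funext => x; have [->//|tx] := eqVneq (t x) 0.
  by exfalso; apply: t0; exists x.
have [g [_ gf]] := norming f.
set w := g f in gf.
have f0 : f != 0 by apply: contraNneq ty0 => f0; rewrite tE f0 scaler0.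
have w0 : w != 0.
  rewrite gf -(of_real0 R k) (inj_eq (can_inj (@of_realK R k))).
  by rewrite gt_eqF// rnorm_gt0.
set c := \prod_i p i (y0 i).
have c0 : c != 0 by apply: contraNneq ty0 => c0; rewrite tE -/c c0 scale0r.
have pi0 i : p i (y0 i) != 0.
  by apply: contraNneq c0; rewrite /c (bigD1 i)//= => ->; rewrite mul0r.
pose phi i : dual (X i) := (c * w)^-1 *: slice i ct y0 g.
have phiE i z : phi i z = p i z / p i (y0 i).
  rewrite -[LHS]/((c * w)^-1 * g (t (dfwith y0 i z))) tE linearZ /= -/w.
  rewrite (bigD1 i)//= dfwithin /c (bigD1 i)//=.
  have -> : \prod_(l < n | l != i) p l (dfwith y0 i z l) =
      \prod_(l < n | l != i) p l (y0 l).
    by apply: eq_bigr => l li; rewrite dfwithout// eq_sym.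
  set q := \prod_(l < n | l != i) _.
  have q0 : q != 0.
    by apply: contraNneq c0; rewrite /c (bigD1 i)//= -/q => ->; rewrite mulr0.
  rewrite -!mulrA [LHS]mulrC invfM mulrACA divff ?mulr1//.
  by rewrite mulf_neq0.
exists [:: (phi, c *: f)]; rewrite big_seq1 /=; apply/funext => x.
rewrite tE /elem_op scalerA; congr (_ *: _).
rewrite (eq_bigr _ (fun i _ => phiE i (x i))) big_split /= prodfV.
by rewrite -/c mulfVK.
Qed.

(** Elementary tensors span a dense subspace of the completion, and the metric
    surjection given by the Radon-Nikodym property is a contraction. *)
Lemma c0_approximable (alpha : forall E : option 'I_n -> normedModType K,
    tensor E -> R) :
  radon_nikodym A alpha F -> approximable A F (fun=> c0_nat R k).
Proof.
move=> RN; have [Y [i [Psi [[_ idense] Plin [Clin CE] [rP nP]]]]] := RN (fun=> nat).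
pose X : 'I_n -> Banach := fun=> c0_nat R k.
have PA y : A X F (Psi y) by rewrite -rP; exists y.
have PB y z : Psi (y - z) = Psi y - Psi z.
  by rewrite addrC -scaleN1r Plin scaleN1r addrC.
move=> T AT e e0.
have [y _ yT] : range Psi T by rewrite rP.
have [_ [z _ <-] yz] := dense_approx y idense e0.
exists (Psi (i z)); split; last first.
  rewrite -yT -PB nP; apply: le_lt_trans yz; apply: ge_inf.
    by exists 0 => _ [w _ <-]; exact: rnorm_ge0.
  by exists (y - i z).
have C0 : Psi (i 0) = 0.
  have := Clin 1 0 0; rewrite !scale1r addr0 => /(congr1 (fun t => t - Psi (i 0))).
  by rewrite subrr addrK.
have [s ->] := tensor_combP z.
elim: s => [|p s IHs].
  by rewrite /tensor_comb big_nil C0; exact: finite_type0.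
rewrite /tensor_comb big_cons Clin; apply: finite_typeD => //.
apply: finite_typeZ.
have {}CE := CE (fun i => p.2 (Some i)) (p.2 None).
have pE : p.2 = opt_point (fun i => p.2 (Some i)) (p.2 None).
  by apply: functional_extensionality_dep => -[l|].
rewrite pE CE.
apply: (@finite_type_prod X (fun l z => l1_c0_pairing (p.2 (Some l)) z)
  (p.2 None)) => //.
apply: (@ideal_continuous_multilinear _ _ _ A); rewrite -CE; exact: PA.
Qed.

End Elementary.

(** * Separability *)

Section Separability.
Variables (R : realType) (k : scalar_kind) (n : nat).
Local Notation K := (scalar_field R k).
Local Notation Banach := (completeNormedModType K).
Variables (A : ideal R k n) (F : Banach) (E : 'I_n -> Banach).
Local Notation N := (ideal_norm A E F).

Lemma ideal_norm_triangle T S U : A E F T -> A E F S -> A E F U ->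
  N (T - U) <= N (T - S) + N (S - U).
Proof.
move=> AT AS AU; have [ND _ _] := ideal_norm_on A E F.
have -> : T - U = (T - S) + (S - U) by rewrite addrA subrK.
by apply: ND; apply: ideal_memB.
Qed.

Lemma elem_op_subr (phi : forall i, dual (E i)) (f g : F) :
  elem_op phi f - elem_op phi g = elem_op phi (f - g).
Proof. by apply/funext => x; rewrite /elem_op scalerBr. Qed.

Lemma elem_op_sub_at (i : 'I_n) (phi : forall i, dual (E i)) (q : dual (E i))
    (f : F) :
  elem_op phi f - elem_op (dfwith phi i q) f =
  elem_op (dfwith phi i (phi i - q)) f.
Proof.
apply/funext => x; rewrite /elem_op -[LHS]/(_ *: f - _ *: f) -scalerBl.
congr (_ *: f); rewrite !(bigD1 (P := xpredT) i)//= !dfwithin.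
have out (r : dual (E i)) : \prod_(l < n | l != i) dfwith phi i r l (x l) =
    \prod_(l < n | l != i) phi l (x l).
  by apply: eq_bigr => l li; rewrite dfwithout// eq_sym.
by rewrite !out -mulrBl.
Qed.

Variables (u : forall i, nat -> dual (E i)) (v : nat -> F).
Hypothesis ud : forall i (phi : dual (E i)) (e : R), 0 < e ->
  exists m, rnorm (phi - u i m) < e.
Hypothesis vd : forall (f : F) (e : R), 0 < e -> exists m, rnorm (f - v m) < e.

(** The functionals are moved into the dense sequences one coordinate at a
    time; an operator with one coordinate changed differs from the old one by an
    operator of the same kind. *)
Lemma elem_op_dense_functionals (r : seq 'I_n) (phi : forall i, dual (E i)) (f : F)
    (e : R) : 0 < e ->
  exists psi : forall i, dual (E i),
    (forall i, i \in r -> exists m, psi i = u i m) /\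
    N (elem_op phi f - elem_op psi f) < e.
Proof.
elim: r e => [|i r IHr] e e0.
  exists phi; split=> //; rewrite subrr.
  have [_ NZ _] := ideal_norm_on A E F.
  have A0 := (ideal_subspace A E F).1.
  by rewrite -(scale0r (0 : (forall i, E i) -> F)) NZ// rnorm0 mul0r.
have e20 : 0 < e / 2 by rewrite divr_gt0.
have [psi [psir psie]] := IHr _ e20.
set M := rnorm f * \prod_(l < n | l != i) rnorm (psi l).
have M0 : 0 <= M.
  by rewrite mulr_ge0 ?rnorm_ge0// prodr_ge0// => l _; exact: rnorm_ge0.
have M1 : 0 < M + 1 by rewrite ltr_wpDl.
have [m um] := ud (psi i) (divr_gt0 e20 M1).
exists (dfwith psi i (u i m)); split=> [l|].
  rewrite inE; have [->|li] := eqVneq l i; first by exists m; rewrite dfwithin.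
  by move=> /= /psir[m' pm]; exists m'; rewrite dfwithout// eq_sym.
have mem (phi' : forall i, dual (E i)) := (elem_op_mem A phi' f).1.
have tri := ideal_norm_triangle (mem phi) (mem psi) (mem (dfwith psi i (u i m))).
apply: (le_lt_trans tri).
rewrite [ltRHS](splitr e) ltr_leD// elem_op_sub_at.
apply: le_trans (elem_op_mem _ _ _).2 _.
rewrite (bigD1 i)//= dfwithin mulrCA.
have -> : \prod_(l < n | l != i) rnorm (dfwith psi i (psi i - u i m) l) =
    \prod_(l < n | l != i) rnorm (psi l).
  by apply: eq_bigr => l li; rewrite dfwithout// eq_sym.
rewrite -/M; apply: le_trans (ler_wpM2r M0 (ltW um)) _.
by rewrite mulrAC -mulrA ler_piMr ?(ltW e20)// ler_pdivrMr// mul1r lerDl.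
Qed.

Definition basic_op (p : {ffun 'I_n -> nat} * nat) : (forall i, E i) -> F :=
  elem_op (fun i => u i (p.1 i)) (v p.2).

Lemma basic_op_dense (phi : forall i, dual (E i)) (f : F) (e : R) : 0 < e ->
  exists p, N (elem_op phi f - basic_op p) < e.
Proof.
move=> e0; have e20 : 0 < e / 2 by rewrite divr_gt0.
set M := \prod_i rnorm (phi i).
have M0 : 0 <= M by rewrite prodr_ge0// => l _; exact: rnorm_ge0.
have M1 : 0 < M + 1 by rewrite ltr_wpDl.
have [b vb] := vd f (divr_gt0 e20 M1).
have [psi [psiu psie]] := elem_op_dense_functionals (enum 'I_n) phi (v b) e20.
have /(_ _)/cid ex i : exists m, psi i = u i m by apply: psiu; rewrite mem_enum.
exists ([ffun i => sval (ex i)], b).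
have -> : basic_op ([ffun i => sval (ex i)], b) = elem_op psi (v b).
  rewrite /basic_op /=; congr elem_op; apply: functional_extensionality_dep => i.
  by rewrite ffunE -(svalP (ex i)).
have mem (phi' : forall i, dual (E i)) (g : F) := (elem_op_mem A phi' g).1.
have tri := ideal_norm_triangle (mem phi f) (mem phi (v b)) (mem psi (v b)).
apply: (le_lt_trans tri).
rewrite [ltRHS](splitr e) ler_ltD// elem_op_subr.
apply: le_trans (elem_op_mem _ _ _).2 _; rewrite -/M.
apply: le_trans (ler_wpM2r M0 (ltW vb)) _.
by rewrite mulrAC -mulrA ler_piMr ?(ltW e20)// ler_pdivrMr// mul1r lerDl.
Qed.

Lemma basic_op_mem (s : seq ({ffun 'I_n -> nat} * nat)) :
  A E F (\sum_(p <- s) basic_op p).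
Proof.
pose op (p : {ffun 'I_n -> nat} * nat) := (fun i => u i (p.1 i), v p.2).
by apply: finite_type_mem; exists [seq op p | p <- s]; rewrite big_map.
Qed.

Lemma finite_type_dense S (e : R) : finite_type S -> 0 < e ->
  exists s : seq ({ffun 'I_n -> nat} * nat), N (S - \sum_(p <- s) basic_op p) < e.
Proof.
move=> [t ->]; elim: t e => [|p t IHt] e e0.
  exists [::]; rewrite !big_nil subrr.
  have [_ NZ _] := ideal_norm_on A E F.
  have A0 := (ideal_subspace A E F).1.
  by rewrite -(scale0r (0 : (forall i, E i) -> F)) NZ// rnorm0 mul0r.
have e20 : 0 < e / 2 by rewrite divr_gt0.
have [s se] := IHt _ e20.
have [q qe] := basic_op_dense p.1 p.2 e20.
exists (q :: s); rewrite !big_cons opprD addrACA [ltRHS](splitr e).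
have [ND _ _] := ideal_norm_on A E F.
apply: le_lt_trans (ND _ _ _ _) _.
- apply: ideal_memB; first exact: (elem_op_mem _ _ _).1.
  exact: (elem_op_mem _ _ _).1.
- apply: ideal_memB; last exact: basic_op_mem.
  by apply: finite_type_mem; exists t.
- exact: ltrD.
Qed.

Lemma separable_on_approximable :
  approximable A F E -> separable_on (A E F) N.
Proof.
move=> appr; exists (range (fun s => \sum_(p <- s) basic_op p)); split.
- exact: (sub_countable (card_image_le _ _) (countableP _)).
- by move=> _ [s _ <-]; exact: basic_op_mem.
move=> T AT e e0; have e20 : 0 < e / 2 by rewrite divr_gt0.
have [S [fS Se]] := appr T AT _ e20.
have [s sE] := finite_type_dense fS e20.
exists (\sum_(p <- s) basic_op p); first by exists s.
have tri := ideal_norm_triangle AT (finite_type_mem A fS) (basic_op_mem s).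
by apply: (le_lt_trans tri); rewrite [ltRHS](splitr e) ltrD.
Qed.

End Separability.

Lemma separable_enum (R : realType) (k : scalar_kind)
    (V : normedModType (scalar_field R k)) : separable V ->
  exists u : nat -> V, forall x (e : R), 0 < e -> exists m, rnorm (x - u m) < e.
Proof.
move=> [D [cD dD]]; have [u uD] := countable_enum 0 cD.
exists u => x e e0; have [d /uD[m <-] xd] := dense_approx x dD e0.
by exists m.
Qed.

(** The variables are replaced by [c0] in their order; the families in between
    have [c0] in the first [s] places and [E] in the others. *)
Lemma approximable_all (R : realType) (k : scalar_kind) (n : nat)
    (A : ideal R k n) (F : completeNormedModType (scalar_field R k))
    (E : 'I_n -> completeNormedModType (scalar_field R k)) :
  arens_stable A F -> extendible A -> (forall i, separable (dual (E i))) ->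
  approximable A F (fun=> c0_nat R k) -> approximable A F E.
Proof.
move=> stab ext sepE base.
pose Z s (i : 'I_n) := if (i < s)%N then c0_nat R k else E i.
have step s : (s < n)%N -> approximable A F (Z s.+1) -> approximable A F (Z s).
  move=> sn appr; apply: (approximable_step stab ext (j := Ordinal sn)).
    by rewrite /Z /= ltnn.
  suff -> : c0_at (Ordinal sn) (Z s) = Z s.+1 by [].
  apply/funext => i; rewrite /c0_at /Z ltnS (leq_eqVlt i s) -val_eqE /=.
  by case: (_ == _).
have Z0 : Z 0%N = E by apply/funext => i; rewrite /Z ltn0.
have Zn : Z n = (fun=> c0_nat R k) by apply/funext => i; rewrite /Z ltn_ord.
rewrite -Z0; suff gen m : (m <= n)%N -> approximable A F (Z (n - m)%N).
  by rewrite -(subnn n); exact: gen.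
elim: m => [_|m IHm mn]; first by rewrite subn0 Zn.
apply: step; first by rewrite ltn_subrL (leq_trans _ mn).
by rewrite -subSn//; exact: IHm (ltnW mn).
Qed.

Theorem proposition2p11 (R : realType) (k : scalar_kind) (n : nat)
    (E : 'I_n -> completeNormedModType (scalar_field R k))
    (F : completeNormedModType (scalar_field R k))
    (A : ideal R k n)
    (alpha : forall X : option 'I_n -> normedModType (scalar_field R k),
       tensor X -> R) :
  (0 < n)%N ->
  separable F ->
  (forall i, separable (dual (E i))) ->
  tensor_norm alpha -> finitely_generated alpha -> associated A alpha ->
  arens_stable A F ->
  extendible A ->
  radon_nikodym A alpha F ->
  separable_on (A E F) (ideal_norm A E F).
Proof.
move=> _ sepF sepE _ _ _ stab ext RN.
have [v vd] := separable_enum sepF.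
have /(_ _)/cid uE i := separable_enum (sepE i).
apply: (@separable_on_approximable _ _ _ A F E (fun i => sval (uE i)) v).
- by move=> i phi e e0; have [m um] := svalP (uE i) phi e e0; exists m.
- exact: vd.
apply: approximable_all => //; exact: c0_approximable RN.
Qed.
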